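(* Let $X_\Delta$ be an $n$-dimensional smooth complete toric variety over $\mathbb{C}$ with fan $\Delta$. For every $1\le k\le n$, $$H^0\Big(X_\Delta,\bigwedge\nolimits^k T_{X_\Delta}\Big)=\bigoplus_{u\in S_k(\Delta)}\chi^u\rho_N(N_u^k).$$ The summand indexed by $u$ is the weight-$(-u)$ subspace $H^0(X_\Delta,\bigwedge^kT_{X_\Delta})_{-u}$ for the action of the torus $T$. If $u\in S(\Delta,i)$, then $$\dim_{\mathbb{C}}\chi^u\rho_N(N_u^k)=\binom{n-i}{k-i}.$$
   Context: Let $N\cong\mathbb{Z}^n$ be a lattice, $M=\operatorname{Hom}(N,\mathbb{Z})$ its dual, $\langle-,-\rangle$ the natural pairing (extended linearly), $N_{\mathbb{R}}=N\otimes\mathbb{R}$, $N_{\mathbb{C}}=N\otimes\mathbb{C}$, $M_{\mathbb{R}}=M\otimes\mathbb{R}$. $\Delta$ is a smooth complete fan in $N_{\mathbb{R}}$, $\Delta(1)$ is its set of rays, and $v_\rho\in N$ is the primitive generator of $\rho\in\Delta(1)$. $X_\Delta$ is the associated toric variety with dense torus $T=N\otimes_{\mathbb{Z}}\mathbb{C}^*$. Global sections are algebraic, equivalently holomorphic by GAGA. The polytope is $P_\Delta=\{u\in M_{\mathbb{R}}\mid\langle u,v_\rho\rangle\ge-1\text{ for every }\rho\in\Delta(1)\}$, a full-dimensional compact polytope. $F\preceq P_\Delta$ means $F$ is a (nonempty) face, $P_\Delta$ itself being the face of codimension $0$; $\operatorname{relint}(F)$ is its relative interior. For $0\le i\le n$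 put $S(\Delta,i)=\bigcup_{F\preceq P_\Delta,\ \operatorname{codim}F=i}(\operatorname{relint}(F)\cap M)$, and $S_k(\Delta)=\bigcup_{i=0}^kS(\Delta,i)$. For $u\in P_\Delta$ put $A(u)=\{\rho\in\Delta(1)\mid\langle u,v_\rho\rangle=-1\}$, $L_u=\operatorname{Span}_{\mathbb{C}}\{v_\rho\mid\rho\in A(u)\}\subseteq N_{\mathbb{C}}$, $i(u)=\dim_{\mathbb{C}}L_u$. For $1\le k\le n$ define $N_u^k\subseteq\bigwedge^kN_{\mathbb{C}}$ by $N_u^k=\bigwedge^{i(u)}L_u\wedge\bigwedge^{k-i(u)}N_{\mathbb{C}}$ if $i(u)\le k$, and $N_u^k=0$ if $i(u)>k$ (here $V\wedge W$ denotes the linear span of all products $v\wedge w$). For $u\in M$, $\chi^u:T\to\mathbb{C}^*$ is the corresponding character, viewed also as a rational function on $X_\Delta$. The infinitesimal torus action gives $\rho_N:N_{\mathbb{C}}\to H^0(X_\Delta,T_{X_\Delta})$ with $\rho_N(x)(\chi^u)=\langle u,x\rangle\chi^u$, and $\rho_N:\bigwedge^kN_{\mathbb{C}}\to H^0(X_\Delta,\bigwedge^kT_{X_\Delta})$ also denotes its (injective) exterior extension. $\chi^u\rho_N(N_u^k)=\{\chi^u\rho_N(\xi)\mid\xi\in N_u^k\}$ is a space of rational $k$-vector fields on $X_\Delta$; global sections are identified with rational $k$-vector fields by restriction to $T$. $T$ acts on $H^0(X_\Delta,\bigwedge^kT_{X_\Delta})$ by $(t\cdot s)(p)=t_*(s(t^{-1}p))$.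 For $m\in M$, the weight-$m$ subspace $H^0(X_\Delta,\bigwedge^kT_{X_\Delta})_m$ consists of the $s$ with $t\cdot s=\chi^m(t)s$ for all $t\in T$. Convention: $\binom{a}{b}=0$ if $b<0$. *)

(* Defs.v *)
From HB Require Import structures.
From mathcomp Require Import all_boot all_order all_algebra.
From mathcomp Require Import perm complex ring.
From mathcomp Require Import all_classical all_reals.
Set Implicit Arguments.
Unset Strict Implicit.
Unset Printing Implicit Defensive.
Import Order.TTheory GRing.Theory Num.Theory.
Local Open Scope classical_set_scope.
Local Open Scope ring_scope.

(* Subspaces of arbitrary, possibly infinite-dimensional, modules are handled
   as sets. *)
Definition lspan (K : pzRingType) (V : lmodType K) (A : set V) : set V :=
  [set x | exists (d : nat) (c : 'I_d -> K) (a : 'I_d -> V),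
      (forall i, A (a i)) /\ x = \sum_i c i *: a i].

Definition has_dim (K : pzRingType) (V : lmodType K) (W : set V) (d : nat) :=
  exists b : 'I_d -> V,
    (forall c : 'I_d -> K, \sum_i c i *: b i = 0 -> forall i, c i = 0) /\
    W = lspan (range b).

(* Meaningful for finite-dimensional subspaces only. *)
Definition vdim (K : pzRingType) (V : lmodType K) (W : set V) : nat :=
  xget 0%N [set d | has_dim W d].

(* Internal direct sum; the W u are meant to be subspaces. *)
Definition is_direct_sum (K : pzRingType) (V : lmodType K) (I : choiceType)
    (H : set V) (S : set I) (W : I -> set V) :=
  H = lspan (\bigcup_(u in S) W u) /\
  forall (r : seq I) (w : I -> V), uniq r ->
    (forall u, u \in r -> S u /\ W u (w u)) ->
    \sum_(u <- r) w u = 0 -> forall u, u \in r -> w u = 0.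

(* N = Z^n consists of row vectors and its dual M = Hom(N, Z) of column
   vectors; likewise after extension of scalars from int to R or R[i], which on
   vectors is map_mx intr. *)
Definition pairing (K : pzRingType) (n : nat) (u : 'cV[K]_n) (x : 'rV[K]_n) : K :=
  (x *m u) 0 0.

Section Fans.
Context {R : realType} {n : nat}.
Implicit Types (sigma tau rho : set 'rV[R]_n) (Delta : set (set 'rV[R]_n)).

Definition cone_hull (A : set 'rV[R]_n) : set 'rV[R]_n :=
  [set x | exists (d : nat) (c : 'I_d -> R) (a : 'I_d -> 'rV[R]_n),
      (forall i, 0 <= c i /\ A (a i)) /\ x = \sum_i c i *: a i].

Definition dual_cone sigma : set 'cV[R]_n :=
  [set u | forall x, sigma x -> 0 <= pairing u x].

Definition rational_polyhedral sigma :=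
  exists s : seq 'rV[int]_n, sigma = cone_hull [set map_mx intr v | v in [set` s]].

Definition strongly_convex sigma := forall x, sigma x -> sigma (- x) -> x = 0.

Definition cone_face tau sigma :=
  exists2 u : 'cV[R]_n, dual_cone sigma u &
    tau = sigma `&` [set x | pairing u x = 0].

Definition is_fan Delta :=
  [/\ finite_set Delta,
      forall sigma, Delta sigma -> rational_polyhedral sigma /\ strongly_convex sigma,
      forall sigma tau, Delta sigma -> cone_face tau sigma -> Delta tau
    & forall sigma tau, Delta sigma -> Delta tau ->
        cone_face (sigma `&` tau) sigma /\ cone_face (sigma `&` tau) tau].

Definition smooth_cone sigma :=
  exists (B : 'M[int]_n) (I : {set 'I_n}), B \in unitmx /\
    sigma = cone_hull [set map_mx intr (row i B) | i in [set` I]].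

Definition smooth_fan Delta := is_fan Delta /\ forall sigma, Delta sigma -> smooth_cone sigma.

Definition complete_fan Delta := \bigcup_(sigma in Delta) sigma = [set: 'rV[R]_n].

Definition rays Delta : set (set 'rV[R]_n) :=
  [set rho | Delta rho /\ has_dim (lspan rho) 1].

Definition primitive (v : 'rV[int]_n) :=
  v != 0 /\ forall (d : int) (w : 'rV[int]_n), v = d *: w -> `|d| = 1.

Definition ray_gen rho : 'rV[int]_n :=
  xget 0 [set v | primitive v /\ rho = cone_hull [set map_mx intr v]].

Definition polytope Delta : set 'cV[R]_n :=
  [set u | forall rho, rays Delta rho -> -1 <= pairing u (map_mx intr (ray_gen rho))].

Definition poly_face (F P : set 'cV[R]_n) :=
  F !=set0 /\ exists (x : 'rV[R]_n) (b : R),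
    (forall u, P u -> b <= pairing u x) /\ F = P `&` [set u | pairing u x = b].

(* Direction space of the affine hull of F. *)
Definition dirsp (F : set 'cV[R]_n) : set 'cV[R]_n :=
  lspan [set p.1 - p.2 | p in F `*` F].

Definition codim_is (F : set 'cV[R]_n) (i : nat) :=
  exists2 d, has_dim (dirsp F) d & (d + i)%N = n.

Definition relint (F : set 'cV[R]_n) : set 'cV[R]_n :=
  [set u | F u /\ exists2 e : R, 0 < e &
     forall w, dirsp F (w - u) -> (forall j, `|w j 0 - u j 0| < e) -> F w].

Definition Sface Delta (i : nat) : set 'cV[int]_n :=
  [set u | exists F, [/\ poly_face F (polytope Delta), codim_is F i
                       & relint F (map_mx intr u)]].

Definition Sface_le Delta (k : nat) : set 'cV[int]_n :=
  \bigcup_(i in [set i | (i <= k)%N]) Sface Delta i.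

End Fans.

(* The k-th exterior power of a module of "1-vectors" D : X -> A (derivations,
   or linear forms on M_C) is realized by alternating maps in k arguments:
   (D_1 /\ ... /\ D_k)(f_1, ..., f_k) = det (D_a f_b). *)
Definition wedgev (X : Type) (A : comPzRingType) (k : nat) (D : 'I_k -> X -> A) :
    ('I_k -> X) -> A :=
  fun f => \det (\matrix_(a, b) D a (f b)).

Section ExteriorPowers.
Context {R : realType} {n : nat}.
Local Notation C := (complex R).

Definition kvec (k : nat) := ('I_k -> 'cV[C]_n) -> C.

Definition ext_power (k : nat) (L : set 'rV[C]_n) : set (kvec k) :=
  lspan [set wedgev (fun a u => pairing u (x a)) | x in [set x | forall a, L (x a)]].

(* The wedge product of alternating maps, normalized so that
   (x_1 /\ ... /\ x_p) /\ (y_1 /\ ... /\ y_q)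
   = x_1 /\ ... /\ x_p /\ y_1 /\ ... /\ y_q. *)
Definition wedge (p q : nat) (v : kvec p) (w : kvec q) : kvec (p + q) :=
  fun f => (p`! * q`!)%:R^-1 *
    \sum_(s : 'S_(p + q)) (-1) ^+ s *
      v (fun a => f (s (lshift q a))) * w (fun b => f (s (rshift p b))).

Definition kvec_cast (k l : nat) (e : k = l) (v : kvec k) : kvec l :=
  fun f => v (fun a => f (cast_ord e a)).

Definition Lu (Delta : set (set 'rV[R]_n)) (u : 'cV[int]_n) : set 'rV[C]_n :=
  lspan [set map_mx intr (ray_gen rho) |
    rho in [set rho | rays Delta rho /\ pairing u (ray_gen rho) = -1]].

(* If vdim (Lu Delta u) > k there is no q, and the span of the empty set is 0. *)
Definition Nu (Delta : set (set 'rV[R]_n)) (k : nat) (u : 'cV[int]_n) : set (kvec k) :=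
  let L := Lu Delta u in
  lspan [set x | exists (q : nat) (e : (vdim L + q)%N = k) v w,
    [/\ ext_power L v, ext_power setT w & x = kvec_cast e (wedge v w)]].

End ExteriorPowers.
Arguments Nu {R n} Delta k u.

Lemma lspan_lin (K : pzRingType) (V : lmodType K) (A : set V) c x y :
  lspan A x -> lspan A y -> lspan A (c *: x + y).
Proof.
move=> [d [a [b [Ab ->]]]] [d' [a' [b' [Ab' ->]]]].
exists (d + d')%N,
  (fun i : 'I_(d + d') => match fintype.split i with inl j => c * a j | inr j => a' j end),
  (fun i : 'I_(d + d') => match fintype.split i with inl j => b j | inr j => b' j end).
split; first by move=> i; case: (fintype.split i).
rewrite big_split_ord scaler_sumr; congr (_ + _); apply: eq_bigr => i _.
  by rewrite (unsplitK (inl i)) scalerA.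
by rewrite (unsplitK (inr i)).
Qed.

Lemma lspan0 (K : pzRingType) (V : lmodType K) (A : set V) : lspan A 0.
Proof. by exists 0%N, (fun _ => 0), (fun _ => 0); split; [case|rewrite big_ord0]. Qed.

Lemma sub_lspan (K : pzRingType) (V : lmodType K) (A : set V) x : A x -> lspan A x.
Proof.
by move=> Ax; exists 1%N, (fun _ => 1), (fun _ => x); rewrite big_ord1 scale1r.
Qed.

Lemma lspan_sum (K : pzRingType) (V : lmodType K) (A : set V) (I : Type) (r : seq I)
    (P : pred I) (c : I -> K) (x : I -> V) :
  (forall i, lspan A (x i)) -> lspan A (\sum_(i <- r | P i) c i *: x i).
Proof.
move=> Ax; elim/big_rec: _ => [|i y _]; first exact: lspan0.
exact: lspan_lin.
Qed.

Section Torus.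
Context {R : realType} {n : nat}.
Local Notation C := (complex R).
Implicit Types (u v : 'cV[int]_n) (sigma : set 'rV[R]_n).

(* T = N (x) C^* = (C^* )^n *)
Record torus := Torus {
  tcoord : 'I_n -> C ;
  tcoord_neq0 : forall i, tcoord i != 0 }.

Definition tmul (t p : torus) : torus :=
  Torus (fun i => mulf_neq0 (tcoord_neq0 t i) (tcoord_neq0 p i)).

Definition tinv (t : torus) : torus :=
  Torus (fun i => invr_neq0 (tcoord_neq0 t i)).

Definition chi u : torus -> C := fun t => \prod_i tcoord t i ^ u i 0.

Lemma chi0 : chi 0 = 1.
Proof. by apply/funext => t; rewrite /chi big1// => i _; rewrite mxE expr0z. Qed.

Lemma chiD u v : chi (u + v) = chi u * chi v.
Proof.
apply/funext => t; rewrite [RHS]/GRing.mul/= /chi -big_split/=.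
by apply: eq_bigr => i _; rewrite mxE expfzDr// tcoord_neq0.
Qed.

Lemma chi_tmul u t p : chi u (tmul t p) = chi u t * chi u p.
Proof.
rewrite /chi -big_split; apply: eq_bigr => i _ /=.
by rewrite exprzMl// unitfE tcoord_neq0.
Qed.

(* Regular functions on U_sigma = Spec C[sigma^vee /\ M], as functions on T. *)
Definition regular sigma : {pred torus -> C} :=
  fun f => `[< lspan [set chi u | u in [set u | dual_cone sigma (map_mx intr u)]] f >].

Lemma regular_chi sigma u : dual_cone sigma (map_mx intr u) -> chi u \in regular sigma.
Proof. by move=> su; apply/asboolP/sub_lspan; exists u. Qed.

Lemma regular_lin sigma c f g :
  f \in regular sigma -> g \in regular sigma -> c *: f + g \in regular sigma.
Proof. by move=> /asboolP sf /asboolP sg; apply/asboolP/lspan_lin. Qed.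

Lemma regular_translate sigma t f :
  f \in regular sigma -> (fun p => f (tmul t p)) \in regular sigma.
Proof.
move=> /asboolP[d [c [a [sa ->]]]]; apply/asboolP.
exists d, (fun i => c i * chi (xget 0 [set u | dual_cone sigma (map_mx intr u) /\ a i = chi u]) t), a.
split=> //; apply/funext => p; rewrite !fct_sumE; apply: eq_bigr => i _.
have [u /= su au] := sa i.
case: xgetP => [v _ [_ av]|/(_ u)/=[]//].
by rewrite -[LHS]/(c i * a i (tmul t p)) -[RHS]/(c i * chi v t * a i p) av chi_tmul mulrA.
Qed.

Fact regular_subring sigma : subring_closed (regular sigma).
Proof.
split.
- rewrite -chi0; apply: regular_chi => x _.
  by rewrite /pairing [map_mx _ 0]raddf0 mulmx0 mxE.
- move=> f g sf sg; rewrite addrC -scaleN1r; exact: regular_lin.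
- move=> f g /asboolP[d [c [a [sa ->]]]] /asboolP[e [b [h [sh ->]]]]; apply/asboolP.
  have -> : (\sum_i c i *: a i) * (\sum_i b i *: h i) =
     \sum_i c i *: (\sum_j b j *: (a i * h j)).
    rewrite mulr_suml; apply: eq_bigr => i _; rewrite mulr_sumr scaler_sumr.
    apply: eq_bigr => j _; apply/funext => t.
    by rewrite -[LHS]/(c i * a i t * (b j * h j t)) mulrACA -mulrA.
  apply: lspan_sum => i; apply: lspan_sum => j; apply: sub_lspan.
  have [u su <-] := sa i; have [v sv <-] := sh j.
  exists (u + v); rewrite ?chiD//= map_mxD => x sx.
  by rewrite /pairing mulmxDr mxE addr_ge0//; [exact: su|exact: sv].
Qed.

Fact regular_subsemimod sigma : subsemimod_closed (regular sigma).
Proof.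
have s0 : 0 \in regular sigma by exact/asboolP/lspan0.
split; first split=> //.
  by move=> f g sf sg; rewrite -[f]scale1r; exact: regular_lin.
by move=> c f sf; rewrite -[_ *: _]addr0; exact: regular_lin.
Qed.

Record regfun sigma := RegFun {
  regval :> torus -> C ;
  regvalP : regval \in regular sigma }.

HB.instance Definition _ sigma := [isSub for @regval sigma].
HB.instance Definition _ sigma := [Choice of regfun sigma by <:].
HB.instance Definition _ sigma :=
  GRing.SubChoice_isSubComPzRing.Build (torus -> C) (regular sigma) (regfun sigma)
    (@regular_subring sigma).
HB.instance Definition _ sigma :=
  GRing.SubZmodule_isSubLmodule.Build C (torus -> C) (regular sigma) (regfun sigma)
    (@regular_subsemimod sigma).

Definition translate sigma (t : torus) (f : regfun sigma) : regfun sigma :=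
  RegFun (regular_translate t (regvalP f)).

(* T is U_sigma for the zero cone sigma. *)
Definition regfunT := regfun [set 0].

Lemma regular_chiT u : chi u \in regular [set 0].
Proof. by apply: regular_chi => x ->; rewrite /pairing mul0mx mxE. Qed.

Definition chiT u : regfunT := RegFun (regular_chiT u).

End Torus.

Section PolyvectorFields.
Context {R : realType} {n : nat}.
Local Notation C := (complex R).
Implicit Types (u : 'cV[int]_n) (sigma tau : set 'rV[R]_n) (x : 'rV[C]_n).

Definition derivation sigma (D : regfun sigma -> regfun sigma) :=
  (forall (c : C) f g, D (c *: f + g) = c *: D f + D g) /\
  forall f g, D (f * g) = D f * g + f * D g.

Definition multimap sigma (k : nat) :=
  ('I_k -> regfun sigma) -> regfun sigma.

(* The sections of the k-th exterior power of the tangent sheaf over the affine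
   variety U_sigma: the k-th exterior power over A = C[U_sigma] of the A-module
   of C-derivations of A. *)
Definition polyvector sigma (k : nat) : set (multimap sigma k) :=
  lspan [set s | exists (h : regfun sigma) (D : 'I_k -> regfun sigma -> regfun sigma),
    (forall a, derivation (D a)) /\ s = fun f => h * wedgev D f].

(* Since functions on U_sigma are given by their values on T, this says that the
   field s on U_sigma restricts to s' on the open subset U_tau. *)
Definition restricts_to sigma tau (k : nat) (s : multimap sigma k) (s' : multimap tau k) :=
  forall (f : 'I_k -> regfun sigma) (g : 'I_k -> regfun tau),
    (forall a, regval (f a) = regval (g a)) -> regval (s f) = regval (s' g).

(* Sections over X_Delta are compatible families of sections over the affine
   open subsets U_sigma; they are identified with their restrictions to T. *)
Definition H0 (Delta : set (set 'rV[R]_n)) (k : nat) : set (multimap [set 0] k) :=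
  [set s | exists S : forall sigma, multimap sigma k,
    [/\ forall sigma, Delta sigma -> polyvector (S sigma),
        forall sigma tau, Delta sigma -> Delta tau -> tau `<=` sigma ->
          restricts_to (S sigma) (S tau)
      & S [set 0] = s]].

(* (t . s)(p) = t_* (s (t^-1 p)), where (t_* w)(df) = w (d(f o t)). *)
Definition torus_act (k : nat) (t : @torus R n) (s : multimap [set 0] k) : multimap [set 0] k :=
  fun f => translate (tinv t) (s (fun a => translate t (f a))).

Definition weight_space (k : nat) (H : set (multimap [set 0] k)) (m : 'cV[int]_n) :=
  [set s | H s /\ forall t, torus_act t s = chi m t *: s].

(* The derivation of C[M] with chi^u |-> <u, x> chi^u; see rhoNP below. *)
Definition rhoN x : @regfunT R n -> @regfunT R n :=
  xget (fun=> 0) [set D | derivation D /\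
    forall u, D (chiT u) = pairing (map_mx intr u) x *: chiT u].

Fact chi_sep u v : u != v -> exists t : @torus R n, chi u t != chi v t.
Proof.
move=> uv; have [i uvi] : exists i, u i 0 != v i 0.
  apply/existsP; apply: contraNT uv; rewrite negb_exists => /forallP e.
  by apply/eqP/matrixP => i j; rewrite ord1; exact/eqP/negPn/e.
have two j : (if j == i then 2 else 1 : C) != 0 by case: ifP; rewrite ?pnatr_eq0 ?oner_eq0.
have chi2 w : chi w (Torus two) = 2 ^ w i 0.
  rewrite /chi (bigD1 i)//= eqxx big1 ?mulr1// => j /negPf ->.
  by rewrite exp1rz.
exists (Torus two); rewrite !chi2; apply: contra uvi => /eqP e; apply/eqP.
have /(ieexprIz (ltr0n _ 2)) : (2 : R) != 1 by rewrite gt_eqF// ltr1n.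
apply; apply: (fmorph_inj (real_complex R)).
by rewrite !fmorphXz rmorph_nat.
Qed.

Fact chi_free (r : seq 'cV[int]_n) (c : 'cV[int]_n -> C) : uniq r ->
  (forall t, \sum_(u <- r) c u * chi u t = 0) -> forall u, u \in r -> c u = 0.
Proof.
elim: r c => // m r IH c /= /andP[mr ur] H.
have c0 u : u \in r -> c u = 0.
  move=> r_u; have [t ut] : exists t : @torus R n, chi u t != chi m t.
    by apply: chi_sep; apply: (contraNneq _ mr) => <-.
  have /eqP : c u * (chi u t - chi m t) = 0.
    apply: (IH (fun v => c v * (chi v t - chi m t)) ur _ u r_u) => p.
    have := H (tmul t p); have := H p; rewrite !big_cons chi_tmul.
    move=> /eqP; rewrite addrC addr_eq0 => /eqP e1.
    move=> /eqP; rewrite mulrCA -[c m * _]opprK -e1 mulrN addrC subr_eq0 => /eqP e2.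
    transitivity (\sum_(v <- r) (c v * chi v (tmul t p) - chi m t * (c v * chi v p))).
      by apply: eq_bigr => v _; rewrite chi_tmul mulrBr mulrBl -mulrA [c v * chi m t]mulrC -mulrA.
    by rewrite sumrB e2 -mulr_sumr subrr.
  by rewrite mulf_eq0 subr_eq0 (negPf ut) orbF => /eqP.
move=> u; rewrite inE => /predU1P[->|/c0//].
have := H (Torus (fun=> oner_neq0 _)); rewrite big_cons big_seq big1 => [|v /c0->].
  by rewrite addr0 /chi big1 ?mulr1// => i _; rewrite exp1rz.
by rewrite mul0r.
Qed.

Definition laurent (s : seq (C * 'cV[int]_n)) : regfunT :=
  \sum_(p <- s) p.1 *: chiT p.2.

Definition laurent_deriv x (s : seq (C * 'cV[int]_n)) : regfunT :=
  \sum_(p <- s) (p.1 * pairing (map_mx intr p.2) x) *: chiT p.2.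

Fact laurentP (f : regfunT) : exists s, f = laurent s.
Proof.
have /asboolP[d [c [a [aP fE]]]] := regvalP f.
have [b bE] : exists b : 'I_d -> 'cV[int]_n, forall i, a i = chi (b i).
  suff /boolp.choice[b bE] : forall i, exists v, a i = chi v by exists b.
  by move=> i; have [v _ <-] := aP i; exists v.
exists [seq (c i, b i) | i <- index_enum 'I_d]; apply: val_inj.
rewrite /laurent big_map raddf_sum/= fE; apply: eq_bigr => i _.
by rewrite bE.
Qed.

Fact laurentE s t : laurent s t = \sum_(p <- s) p.1 * chi p.2 t.
Proof. by rewrite -[regval _]/(val _) /laurent raddf_sum/= fct_sumE. Qed.

Fact laurent_derivE x s t : laurent_deriv x s t =
  \sum_(p <- s) p.1 * pairing (map_mx intr p.2) x * chi p.2 t.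
Proof. by rewrite -[regval _]/(val _) /laurent_deriv raddf_sum/= fct_sumE. Qed.

Fact laurent_deriv0 x s : laurent s = 0 -> laurent_deriv x s = 0.
Proof.
move=> s0; apply: val_inj; apply/funext => t; rewrite /= laurent_derivE.
pose r := undup [seq p.2 | p <- s].
have part (F : C * 'cV[int]_n -> C) :
    \sum_(p <- s) F p = \sum_(u <- r) \sum_(p <- s | p.2 == u) F p.
  rewrite (exchange_big_dep xpredT)//= [LHS]big_seq [RHS]big_seq.
  apply: eq_bigr => p sp; rewrite -big_filter.
  rewrite (@eq_filter _ _ (pred1 p.2)) => [|u]; last by rewrite /= eq_sym.
  by rewrite filter_pred1_uniq ?undup_uniq ?big_seq1// mem_undup map_f.
pose c u := \sum_(p <- s | p.2 == u) p.1.
have c0 u : u \in r -> c u = 0.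
  apply: (chi_free (undup_uniq _)) => t'.
  have : laurent s t' = 0 by rewrite s0.
  rewrite laurentE part; apply: etrans.
  by apply: eq_bigr => v _; rewrite mulr_suml; apply: eq_bigr => p /eqP->.
rewrite part big_seq big1// => u /c0 cu.
transitivity (c u * (pairing (map_mx intr u) x * chi u t)); last by rewrite cu mul0r.
by rewrite mulr_suml; apply: eq_bigr => p /eqP->; rewrite mulrA.
Qed.

Fact laurent_deriv_lin x c s s' :
  let s'' := [seq (c * p.1, p.2) | p <- s] ++ s' in
  laurent s'' = c *: laurent s + laurent s' /\
  laurent_deriv x s'' = c *: laurent_deriv x s + laurent_deriv x s'.
Proof.
rewrite /laurent /laurent_deriv !big_cat !big_map !scaler_sumr.
by split; congr (_ + _); apply: eq_bigr => p _; rewrite scalerA ?mulrA.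
Qed.

Fact laurent_deriv_wd x s s' : laurent s = laurent s' ->
  laurent_deriv x s = laurent_deriv x s'.
Proof.
move=> ss'; have [e1 e2] := laurent_deriv_lin x (-1) s' s.
apply/eqP; rewrite -subr_eq0 addrC -scaleN1r -e2; apply/eqP/laurent_deriv0.
by rewrite e1 ss' scaleN1r addNr.
Qed.

Fact rhoNP x : derivation (rhoN x) /\
  forall u, rhoN x (chiT u) = pairing (map_mx intr u) x *: chiT u.
Proof.
rewrite /rhoN; case: xgetP => [//|none]; exfalso.
have /boolp.choice[rep repE] := laurentP.
apply: (none (fun f => laurent_deriv x (rep f))); split; [split|].
- move=> c f g; rewrite -(laurent_deriv_lin x c _ _).2.
  by apply: laurent_deriv_wd; rewrite (laurent_deriv_lin x c _ _).1 -!repE.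
- have repV (f : regfunT) t : f t = \sum_(p <- rep f) p.1 * chi p.2 t by rewrite {1}(repE f) laurentE.
  move=> f g; pose fg := [seq (p.1 * q.1, p.2 + q.2) | p <- rep f, q <- rep g].
  have mulE (F G : C * 'cV[int]_n -> C) :
      (\sum_(p <- rep f) F p) * (\sum_(q <- rep g) G q) =
      \sum_(p <- rep f) \sum_(q <- rep g) F p * G q.
    by rewrite mulr_suml; apply: eq_bigr => p _; rewrite mulr_sumr.
  have -> : laurent_deriv x (rep (f * g)) = laurent_deriv x fg.
    apply: laurent_deriv_wd; rewrite -repE; apply: val_inj; apply/funext => t.
    rewrite /= laurentE -[LHS]/(f t * g t) !repV mulE.
    rewrite big_allpairs_dep; apply: eq_bigr => p _; apply: eq_bigr => q _ /=.
    by rewrite chiD mulrACA.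
  apply: val_inj; apply/funext => t; rewrite /= laurent_derivE big_allpairs_dep.
  rewrite -[RHS]/(laurent_deriv x (rep f) t * g t + f t * laurent_deriv x (rep g) t).
  rewrite !laurent_derivE !repV !mulE.
  rewrite -big_split; apply: eq_bigr => p _; rewrite -big_split; apply: eq_bigr => q _ /=.
  rewrite chiD map_mxD /pairing mulmxDr mxE -[(chi _ * chi _) t]/(chi _ t * chi _ t).
  by ring.
- move=> u; transitivity (laurent_deriv x [:: (1, u)]).
    by apply: laurent_deriv_wd; rewrite -repE /laurent big_seq1 scale1r.
  by rewrite /laurent_deriv big_seq1 mul1r.
Qed.

(* The k-th exterior power of rhoN: v is the sum of
   v(e^*_{i_1}, ..., e^*_{i_k}) e_{i_1} /\ ... /\ e_{i_k} over i_1 < ... < i_k,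
   i.e., 1/k! times the sum over all k-tuples i. *)
Definition rhoNk (k : nat) (v : @kvec R n k) : multimap [set 0] k :=
  (k`!%:R)^-1 *: \sum_(i : {ffun 'I_k -> 'I_n})
    v (fun a => delta_mx (i a) 0) *: wedgev (fun a => rhoN (delta_mx 0 (i a))).

Definition summand (Delta : set (set 'rV[R]_n)) (k : nat) u : set (multimap [set 0] k) :=
  [set (fun f => chiT u * rhoNk v f) | v in Nu Delta k u].

End PolyvectorFields.
Arguments polyvector {R n} sigma k.
Arguments H0 {R n} Delta k.
Arguments summand {R n} Delta k u.

(* Main.v *)
(* On the torus every derivation is a combination of the fields [rhoN x] with Laurent
   polynomial coefficients, so a polyvector field is uniquely a finite sum of terms
   [chi^u rho(v)], and the torus acts on such a term with weight [-u].  Evaluated on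
   characters, [chi^u rho(v)] maps [chi^(m_1), ..., chi^(m_k)] to
   [v(m_1, ..., m_k) chi^(u + m_1 + ... + m_k)].  Regularity on the affine piece of a ray
   with generator [b], tested on a dual basis, therefore says that [<u, b> >= -1] and,
   in case of equality, that [v /\ b = 0].  Conversely, on a smooth cone these conditions
   make [chi^u rho(v)] a combination of products of partial derivatives in the toric
   coordinates with regular coefficients.  Finally, [v /\ v_rho = 0] for all [rho] in
   [A(u)] means that [v] is divisible by the top exterior power of [L_u]: expand [v] in a
   basis that starts with generators spanning [L_u].  The face of the polytope with [u]
   in its relative interior has direction space orthogonal to [A(u)], so its codimension
   is [i(u)]. *)
From HB Require Import structures.
Require Import Defs.
From mathcomp Require Import all_boot all_order all_algebra.
From mathcomp Require Import perm complex ring.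
From mathcomp Require Import all_classical all_reals.
Set Implicit Arguments.
Unset Strict Implicit.
Unset Printing Implicit Defensive.
Import Order.TTheory GRing.Theory Num.Theory.
Local Open Scope classical_set_scope.
Local Open Scope ring_scope.

(** The pivot is [vanishing]. The space [N_u^k] is given by generators, while regularity yields
    linear equations on [v]; both are identified with the condition that [v] is zero on every tuple
    orthogonal to one of the active generators.

    Alternating maps are expanded over all [k]-tuples of basis indices, with the factor [1/k!],
    rather than over increasing tuples. Coefficients are then plain values on dual tuples;
    representatives up to order are chosen only to count a basis.

    A global section mixes several weights, so regularity says nothing about a single term until the
    independence of characters isolates its exponent. Necessity of the conditions is tested on the
    charts of rays, which see one generator each; sufficiency is checked on every cone, where
    compatibility follows from agreement on the torus.

    Integrality of [u] enters through the gap it creates: an inequality [<u, v_rho> >= -1] that is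
    not an equality gives [<u, v_rho> >= 0]. This supplies both the room to move inside a face and
    the nonnegative exponents in a chart. *)

(** * Determinant expansions over arbitrary tuples *)

Section Determinants.
Variable A : comPzRingType.

Lemma det_mulmx_ffun (k n : nat) (X : 'M[A]_(k, n)) (Y : 'M[A]_(n, k)) :
  \det (X *m Y) =
    \sum_(i : {ffun 'I_k -> 'I_n}) (\prod_a X a (i a)) * \det (rowsub i Y).
Proof.
rewrite /determinant.
under eq_bigr => s _.
  under eq_bigr => a _ do rewrite mxE.
  rewrite (bigA_distr_bigA (fun a j => X a j * Y j (s a))) mulr_sumr.
  over.
rewrite exchange_big; apply: eq_bigr => i _ /=.
rewrite mulr_sumr; apply: eq_bigr => s _.
rewrite big_split /= mulrCA; congr (_ * (_ * _)).
by apply: eq_bigr => a _; rewrite !mxE.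
Qed.

Lemma det_rowsub_perm (k n : nat) (Y : 'M[A]_(n, k)) (i : 'I_k -> 'I_n) (s : 'S_k) :
  \det (rowsub (fun a => i (s a)) Y) = (-1) ^+ s * \det (rowsub i Y).
Proof.
rewrite -det_perm -det_mulmx -row_permE; congr (\det _).
by apply/matrixP => a b; rewrite !mxE.
Qed.

(** Tuples with a repetition contribute zero and each [k]-subset occurs in all its orders, whence
    [k!]. In the proof, reindexing the tuples by the permutation [s] from the first determinant
    cancels its sign, so every [s] contributes one copy of [\det (X *m Y)]. *)
Lemma cauchy_binet_ffun (k n : nat) (X : 'M[A]_(k, n)) (Y : 'M[A]_(n, k)) :
  \sum_(i : {ffun 'I_k -> 'I_n}) \det (colsub i X) * \det (rowsub i Y) =
    k`!%:R * \det (X *m Y).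
Proof.
have -> : k`!%:R * \det (X *m Y) = \sum_(s : 'S_k) \det (X *m Y).
  by rewrite sumr_const mulr_natl -card_Sn; congr (_ *+ _); apply: eq_card.
under eq_bigr => i _ do rewrite mulr_suml.
rewrite exchange_big; apply: eq_bigr => s _ /=.
have sK : cancel (fun j : {ffun 'I_k -> 'I_n} => [ffun a => j ((s^-1)%g a)])
                 (fun j => [ffun a => j (s a)]).
  by move=> j; apply/ffunP => a; rewrite !ffunE permK.
rewrite (reindex_inj (can_inj sK)) det_mulmx_ffun; apply: eq_bigr => j _.
have -> : rowsub [ffun a => j ((s^-1)%g a)] Y = rowsub (fun a => j ((s^-1)%g a)) Y.
  by apply/matrixP => a b; rewrite !mxE ffunE.
rewrite det_rowsub_perm odd_permV mulrACA -expr2 sqrr_sign mul1r.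
by congr (_ * _); apply: eq_bigr => a _; rewrite mxE ffunE permK.
Qed.

Lemma det_col_mx_row_perm (p q : nat) (X : 'M[A]_(p, p + q)) (Y : 'M[A]_(q, p + q))
    (s : 'S_p) (t : 'S_q) :
  \det (col_mx (row_perm s X) (row_perm t Y)) =
    (-1) ^+ s * (-1) ^+ t * \det (col_mx X Y).
Proof.
rewrite -!det_perm -(det_ublock (perm_mx s) 0 (perm_mx t)) -det_mulmx.
by rewrite mul_block_col !mul0mx addr0 add0r -!row_permE.
Qed.

End Determinants.

(** * Expansion of multivectors in dual bases *)

Section Kvectors.
Context {R : realType} {n : nat}.
Local Notation C := (complex R).

Definition decomposable (k : nat) (x : 'I_k -> 'rV[C]_n) : kvec k :=
  wedgev (fun a u => pairing u (x a)).

Definition cols (k : nat) (f : 'I_k -> 'cV[C]_n) : 'M[C]_(n, k) :=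
  \matrix_(j, b) f b j 0.

Lemma decomposableE (k : nat) (x : 'I_k -> 'rV[C]_n) f :
  decomposable x f = \det ((\matrix_a x a) *m cols f).
Proof.
congr (\det _); apply/matrixP => a b; rewrite [LHS]mxE /pairing !mxE.
by apply: eq_bigr => j _; rewrite !mxE.
Qed.

Lemma wedgev_eq0 (X : Type) (A : comPzRingType) (k : nat) (D : 'I_k -> X -> A) :
  ~~ injectiveb D -> wedgev D = 0.
Proof.
move=> /injectivePn[a [b ab Dab]]; apply/funext => f.
by apply: (determinant_alternate ab) => c; rewrite !mxE Dab.
Qed.

Lemma ext_powerE (k : nat) (L : set 'rV[C]_n) (v : kvec k) : ext_power L v ->
  exists (d : nat) (c : 'I_d -> C) (x : 'I_d -> 'I_k -> 'rV[C]_n),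
    (forall e a, L (x e a)) /\ forall f, v f = \sum_e c e * decomposable (x e) f.
Proof.
move=> [d [c [w [wP ->]]]].
have /boolp.choice[x xP] : forall e, exists x, (forall a, L (x a)) /\ decomposable x = w e.
  by move=> e; have [x Lx <-] := wP e; exists x.
exists d, c, x; split=> [e a|f]; first exact: (xP e).1.
by rewrite fct_sumE; apply: eq_bigr => e _; rewrite (xP e).2.
Qed.

(** For a decomposable [v] this is Cauchy-Binet for the factorization of its matrix through
    [invmx B *m B]. The columns of [invmx B] are the basis dual to the rows of [B]. *)
Lemma ext_power_expandE (k : nat) (B : 'M[C]_n) (v : kvec k) f : B \in unitmx ->
  ext_power setT v ->
  v f = k`!%:R^-1 * \sum_(i : {ffun 'I_k -> 'I_n})
    v (fun a => col (i a) (invmx B)) * decomposable (fun a => row (i a) B) f.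
Proof.
move=> uB /ext_powerE[d [c [x [_ vE]]]]; rewrite vE.
under [in RHS]eq_bigr => i _ do rewrite vE mulr_suml.
rewrite exchange_big mulr_sumr; apply: eq_bigr => e _ /=.
under [in RHS]eq_bigr => i _ do rewrite -mulrA.
rewrite -mulr_sumr mulrCA; congr (_ * _).
have -> : decomposable (x e) f = \det ((\matrix_a x e a) *m invmx B *m (B *m cols f)).
  by rewrite mulmxA mulmxKV// decomposableE.
set X := _ *m invmx B; set Y := B *m _.
have -> : \det (X *m Y) = k`!%:R^-1 * (k`!%:R * \det (X *m Y)).
  by rewrite mulKf// pnatr_eq0 -lt0n fact_gt0.
rewrite -cauchy_binet_ffun.
apply: (congr1 (fun z => k`!%:R^-1 * z)); apply: eq_bigr => i _.
rewrite !decomposableE; apply: (f_equal2 (fun y z : C => y * z)); apply: (congr1 determinant).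
  by rewrite /X -mulmx_colsub; congr (_ *m _); apply/matrixP => a b; rewrite !mxE.
by rewrite /Y -mul_rowsub_mx; congr (_ *m _); apply/matrixP => a b; rewrite !mxE.
Qed.

Lemma ext_power_expand (k : nat) (B : 'M[C]_n) (v : kvec k) : B \in unitmx ->
  ext_power setT v ->
  v = k`!%:R^-1 *: \sum_(i : {ffun 'I_k -> 'I_n})
    v (fun a => col (i a) (invmx B)) *: decomposable (fun a => row (i a) B).
Proof.
move=> uB vP; apply/funext => f; rewrite (ext_power_expandE f uB vP).
by rewrite -[RHS]/(_ * _) fct_sumE.
Qed.

End Kvectors.

(** Laplace expansion along the first [p] rows. Summing over permutations instead of [p]-subsets of
    columns counts each splitting [p! q!] times, which is the factor divided out in [wedge]. *)
Lemma laplace_perm (A : comPzRingType) (p q : nat)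
    (P : 'M[A]_(p, p + q)) (Q : 'M[A]_(q, p + q)) :
  \sum_(s : 'S_(p + q)) (-1) ^+ s * \det (colsub (fun a => s (lshift q a)) P) *
      \det (colsub (fun b => s (rshift p b)) Q) =
    (p`! * q`!)%:R * \det (col_mx P Q).
Proof.
have detE m (M : 'M[A]_(m, p + q)) (i : 'I_m -> 'I_(p + q)) :
    \det (colsub i M) = \sum_(t : 'S_m) (-1) ^+ t * \prod_a row_perm t M a (i a).
  rewrite -det_tr; apply: eq_bigr => t _; congr (_ * _).
  by apply: eq_bigr => a _; rewrite !mxE.
(* Permuting the rows within each block changes the determinant by a sign that is compensated, so
   the multiple [p! q!] becomes a sum over [u] and [t] that matches the expansions of the two
   minors. *)
transitivity (\sum_(u : 'S_p) \sum_(t : 'S_q) (-1) ^+ u * (-1) ^+ t *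
    \det (col_mx (row_perm u P) (row_perm t Q))); last first.
  under eq_bigr => u _.
    under eq_bigr => t _ do
      rewrite det_col_mx_row_perm mulrA mulrACA -!expr2 !sqrr_sign mul1r mul1r.
    over.
  rewrite !sumr_const -mulrnA -[LHS]mulr_natl; congr (_%:R * _).
  by rewrite mulnC -!card_Sn; congr (_ * _)%N; apply: eq_card.
under eq_bigr => s _ do rewrite !detE.
under eq_bigr => s _.
  rewrite -mulrA mulr_suml mulr_sumr.
  under eq_bigr => u _ do rewrite mulr_sumr mulr_sumr.
  over.
rewrite exchange_big; apply: eq_bigr => u _ /=.
rewrite exchange_big; apply: eq_bigr => t _ /=.
rewrite mulr_sumr; apply: eq_bigr => s _.
rewrite big_split_ord /=.
have -> : \prod_(i < p) (col_mx (row_perm u P) (row_perm t Q)) (lshift q i) (s (lshift q i))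
   = \prod_a row_perm u P a (s (lshift q a)).
  by apply: eq_bigr => a _; rewrite col_mxEu.
have -> : \prod_(i < q) (col_mx (row_perm u P) (row_perm t Q)) (rshift p i) (s (rshift p i))
   = \prod_a row_perm t Q a (s (rshift p a)).
  by apply: eq_bigr => a _; rewrite col_mxEd.
move: (\prod_a _) (\prod_a _) ((-1) ^+ s) ((-1) ^+ u) ((-1) ^+ t) => *; ring.
Qed.

Section SubsetTransversal.
Local Open Scope set_scope.

(** One ordering is fixed for every [(p + q)]-subset that contains the first [p] indices: those come
    first, followed by a [q]-subset of the others. The third clause lets any admissible tuple be
    sorted; the last one makes distinct choices separable by a dual basis. *)
Lemma subset_transversal (n p q : nat) : (p <= n)%N ->
  exists G : 'I_('C(n - p, q)) -> 'I_(p + q) -> 'I_n,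
  [/\ forall e a, G e (lshift q a) = a :> nat,
      forall e, injective (G e),
      forall i : 'I_(p + q) -> 'I_n, injective i ->
        (forall l : 'I_n, (l < p)%N -> exists a, i a = l) ->
        exists e (s : 'S_(p + q)), forall a, i (s a) = G e a
    & forall e e', e != e' -> exists a, forall b, G e a != G e' b].
Proof.
move=> lepn.
pose Z := [set j : 'I_n | (p <= j)%N].
have cardZC : #|~: Z| = p.
  have -> : ~: Z = [set widen_ord lepn l | l in [set: 'I_p]].
    apply/setP => j; rewrite !inE -ltnNge; apply/idP/imsetP => [jp|[l _ ->]//=].
    by exists (Ordinal jp) => //; apply: val_inj.
  rewrite card_imset ?cardsT ?card_ord// => a b /(congr1 val)/= ab.
  exact: val_inj.
have cardZ : #|Z| = (n - p)%N.
  by have := cardsC Z; rewrite cardZC card_ord => /(canRL (addnK _)).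
pose D := [set J : {set 'I_n} | J \subset Z & #|J| == q].
have cardD : #|D| = 'C(n - p, q) by rewrite cards_draws cardZ.
pose J (e : 'I_('C(n - p, q))) : {set 'I_n} := enum_val (cast_ord (esym cardD) e).
have JP e : J e \subset Z /\ #|J e| = q.
  by have := enum_valP (cast_ord (esym cardD) e); rewrite !inE => /andP[? /eqP].
have Jinj : injective J by move=> e e' /enum_val_inj/cast_ord_inj.
have Jsurj (K : {set 'I_n}) : K \subset Z -> #|K| = q -> exists e, J e = K.
  move=> KZ cK; have KD : K \in D by rewrite inE KZ cK eqxx.
  exists (cast_ord cardD (enum_rank_in KD K)).
  by rewrite /J cast_ordK enum_rankK_in.
pose g e (r : 'I_q) : 'I_n := enum_val (cast_ord (esym (JP e).2) r).
have gJ e r : g e r \in J e by exact: enum_valP.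
have ginj e : injective (g e) by move=> r r' /enum_val_inj/cast_ord_inj.
have gsurj e j : j \in J e -> exists r, g e r = j.
  move=> jJ; exists (cast_ord (JP e).2 (enum_rank_in jJ j)).
  by rewrite /g cast_ordK enum_rankK_in.
pose G e (a : 'I_(p + q)) :=
  match fintype.split a with inl l => widen_ord lepn l | inr r => g e r end.
have Gl e a : G e (lshift q a) = a :> nat by rewrite /G (unsplitK (inl a)).
have Gr e r : G e (rshift p r) = g e r by rewrite /G (unsplitK (inr r)).
have gZ e r : (p <= g e r)%N by have /fintype.subsetP/(_ _ (gJ e r)) := (JP e).1; rewrite inE.
have Gim e (j : 'I_n) : (j < p)%N || (j \in J e) -> exists a, G e a = j.
  case/orP=> [jp|/gsurj[r <-]]; last by exists (rshift p r).
  by exists (lshift q (Ordinal jp)); apply: val_inj => /=; rewrite Gl.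
have Ginj e : injective (G e).
  move=> a b; rewrite /G -{2}[a]splitK -{2}[b]splitK.
  case: (fintype.split a) => [l|r]; case: (fintype.split b) => [l'|r'] /=.
  + by move=> /(congr1 val)/= ll'; congr lshift; apply: val_inj.
  + by move=> /(congr1 val)/= ll'; have := gZ e r'; rewrite -ll' leqNgt ltn_ord.
  + by move=> /(congr1 val)/= ll'; have := gZ e r; rewrite ll' leqNgt ltn_ord.
  + by move=> /ginj->.
exists G; split=> //.
- move=> i iinj ip.
  pose I := [set i a | a in [set: 'I_(p + q)]].
  have cI : #|I| = (p + q)%N by rewrite card_imset// cardsT card_ord.
  have ZI : ~: Z \subset I.
    apply/fintype.subsetP => l; rewrite !inE -ltnNge => /ip[a <-].
    by apply/imsetP; exists a.
  have [e Je] : exists e, J e = I :&: Z.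
    apply: Jsurj; first exact: finset.subsetIr.
    have := cardsID Z I; rewrite cI finset.setDE (finset.setIidPr ZI) cardZC addnC.
    by move/addnI.
  have /boolp.choice[s sP] : forall a, exists c, i c = G e a.
    move=> a; have : G e a \in I.
      rewrite -[a]splitK; case: (fintype.split a) => [l|r] /=.
        apply: (fintype.subsetP ZI); rewrite !inE -ltnNge Gl; exact: ltn_ord.
      by rewrite Gr; have := gJ e r; rewrite Je inE => /andP[].
    by case/imsetP => c _ ->; exists c.
  have sinj : injective s.
    by move=> a b sab; apply: (Ginj e); rewrite -!sP sab.
  by exists e, (perm sinj) => a; rewrite permE.
- move=> e e' ee'.
  have /fintype.subsetPn[j jJ jJ'] : ~~ (J e \subset J e').
    apply: contra ee' => JJ'; apply/eqP/Jinj/eqP.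
    by rewrite eqEcard JJ' !(JP _).2 leqnn.
  have [r rj] := gsurj e j jJ; exists (rshift p r) => b.
  rewrite Gr rj; apply: contraNneq jJ' => jb.
  have := fintype.subsetP (JP e).1 j jJ; rewrite jb inE.
  rewrite -[b]splitK; case: (fintype.split b) => [l|r'] /=; last by rewrite Gr.
  by rewrite Gl leqNgt ltn_ord.
Qed.

End SubsetTransversal.

(** * Spans, row spaces and dimensions *)

Lemma lspan_sub (K : pzRingType) (V : lmodType K) (A W : set V) :
  A `<=` W -> W 0 -> (forall c x y, W x -> W y -> W (c *: x + y)) -> lspan A `<=` W.
Proof.
move=> AW W0 Wlin x [d [c [a [aA ->]]]].
by elim/big_rec: _ => // i y _ Wy; apply: Wlin => //; apply: AW.
Qed.

Lemma linear_at0 (K : pzRingType) (U V : lmodType K) (f : U -> V) :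
  (forall c x y, f (c *: x + y) = c *: f x + f y) -> f 0 = 0.
Proof. by move=> flin; have := flin (-1) 0 0; rewrite scaler0 addr0 scaleN1r addNr. Qed.

Lemma image_lspan (K : pzRingType) (U V : lmodType K) (f : U -> V) (A : set U) :
  (forall c x y, f (c *: x + y) = c *: f x + f y) -> f @` lspan A = lspan (f @` A).
Proof.
move=> flin.
have f0 := linear_at0 flin.
apply/seteqP; split=> y.
  case=> x Ax <-; move: x Ax; apply: lspan_sub => [x Ax||c x z Ax Az].
  - by apply: sub_lspan; exists x.
  - by rewrite f0; exact: lspan0.
  - by rewrite flin; exact: lspan_lin.
move: y; apply: lspan_sub => [_ [x Ax <-]||c _ _ [x Ax <-] [z Az <-]].
- by exists x => //; exact: sub_lspan.
- by exists 0 => //; exact: lspan0.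
- by exists (c *: x + z) => //; exact: lspan_lin.
Qed.

Lemma has_dim_image (K : pzRingType) (U V : lmodType K) (f : U -> V) (W : set U) d :
  (forall c x y, f (c *: x + y) = c *: f x + f y) ->
  (forall x, W x -> f x = 0 -> x = 0) -> has_dim W d -> has_dim (f @` W) d.
Proof.
move=> flin finj [b [bfree WE]]; exists (f \o b); split; last first.
  by rewrite WE image_lspan// image_comp.
have f0 := linear_at0 flin.
have fsum c : f (\sum_i c i *: b i) = \sum_i c i *: f (b i).
  by elim/big_ind2: _ => // [x x' y y' <- <-|i _];
    [rewrite -[x']scale1r flin !scale1r|rewrite -[_ *: b i]addr0 flin f0 addr0].
move=> c; rewrite -fsum => /finj c0; apply: bfree; apply: c0.
rewrite WE; apply: lspan_sum => i; apply: sub_lspan; exists i => //.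
Qed.

Section RowSpaces.
Variables (K : fieldType) (n : nat).
Implicit Types (W : set 'rV[K]_n).

Lemma lspan_rows (m : nat) (M : 'M[K]_(m, n)) :
  lspan [set row i M | i in setT] = [set x : 'rV[K]_n | (x <= M)%MS].
Proof.
apply/seteqP; split=> x.
  move: x; apply: lspan_sub => [_ [i _ <-]||c x y /= xM yM] /=.
  - exact: row_sub.
  - exact: sub0mx.
  - by rewrite addmx_sub// scalemx_sub.
case/submxP => D ->; rewrite mulmx_sum_row.
by apply: lspan_sum => i; apply: sub_lspan; exists i.
Qed.

Lemma has_dim_rowsP W d :
  has_dim W d <-> exists2 M : 'M[K]_(d, n), row_free M & W = [set x : 'rV[K]_n | (x <= M)%MS].
Proof.
split=> [[b [bfree ->]]|[M Mfree ->]].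
  exists (\matrix_i b i); last first.
    rewrite -lspan_rows; congr lspan; apply/seteqP.
    by split=> _ [i _ <-]; exists i; rewrite // rowK.
  apply: inj_row_free => c; rewrite mulmx_sum_row => c0.
  apply/rowP => i; rewrite mxE; apply: (bfree (c 0)).
  by rewrite -[RHS]c0; apply: eq_bigr => j _; rewrite rowK.
exists (fun i => row i M); split; last by rewrite -lspan_rows.
move=> c c0 i; have : (\row_j c j) *m M = 0.
  by rewrite mulmx_sum_row -[RHS]c0; apply: eq_bigr => j _; rewrite mxE.
by rewrite -[RHS](mul0mx _ M) => /(row_free_inj Mfree)/rowP/(_ i); rewrite !mxE.
Qed.

Lemma has_dim_submx (m : nat) (M : 'M[K]_(m, n)) d :
  has_dim [set x : 'rV[K]_n | (x <= M)%MS] d <-> d = \rank M.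
Proof.
rewrite has_dim_rowsP; split=> [[N Nfree /seteqP[MN NM]]|->].
  apply/eqP; rewrite -(eqP Nfree) eqn_leq.
  apply/andP; split; apply: mxrankS; apply/row_subP => i.
    by apply: NM => /=; exact: row_sub.
  by apply: MN => /=; exact: row_sub.
exists (row_base M); first exact: row_base_free.
by apply/seteqP; split=> x /=; rewrite eq_row_base.
Qed.

End RowSpaces.

Lemma has_dim_ker (K : fieldType) (m n : nat) (M : 'M[K]_(m, n)) d :
  has_dim [set w : 'cV[K]_n | M *m w = 0] d <-> d = (n - \rank M)%N.
Proof.
have trlin p q c (x y : 'M[K]_(p, q)) : (c *: x + y)^T = c *: x^T + y^T.
  by rewrite linearP.
have kerE : [set w : 'cV[K]_n | M *m w = 0] = trmx @` [set x : 'rV[K]_n | (x <= kermx M^T)%MS].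
  apply/seteqP; split=> [w /= Mw|_ [x /sub_kermxP xM <-] /=].
    exists w^T; last by rewrite trmxK.
    by apply/sub_kermxP; rewrite -trmx_mul Mw trmx0.
  by rewrite -[M]trmxK -trmx_mul xM trmx0.
have -> : (n - \rank M)%N = \rank (kermx M^T) by rewrite mxrank_ker mxrank_tr.
rewrite -has_dim_submx kerE; split; last first.
  apply: has_dim_image; first exact: trlin.
  by move=> x _ /(congr1 trmx); rewrite trmxK trmx0.
move=> Wd; rewrite -[X in has_dim X](image_id) -(_ : trmx \o trmx = id).
  rewrite -image_comp; apply: has_dim_image Wd; first exact: trlin.
  by move=> x _ /(congr1 trmx); rewrite trmxK trmx0.
by apply/funext => x /=; rewrite trmxK.
Qed.

Lemma det_row0 (A : comPzRingType) (k : nat) (M : 'M[A]_k) (a : 'I_k) :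
  (forall b, M a b = 0) -> \det M = 0.
Proof. by move=> Ma; rewrite (expand_det_row _ a) big1// => b _; rewrite Ma mul0r. Qed.

Lemma wedgev_perm (X : Type) (A : comPzRingType) (k : nat) (D : 'I_k -> X -> A)
    (s : 'S_k) f : wedgev (fun a => D (s a)) f = (-1) ^+ s * wedgev D f.
Proof.
rewrite /wedgev -det_perm -det_mulmx -row_permE.
by congr (\det _); apply/matrixP => a b; rewrite !mxE.
Qed.

Lemma pairing_dual_basis (K : comUnitRingType) (n : nat) (B : 'M[K]_n) (i j : 'I_n) :
  B \in unitmx -> pairing (col j (invmx B)) (row i B) = (i == j)%:R.
Proof.
by move=> uB; rewrite /pairing colE mulmxA -row_mul mulmxV// -colE !mxE.
Qed.

(** * Multivectors divisible by the leading vectors of a basis *)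

Section Vanishing.
Context {R : realType} {n : nat}.
Local Notation C := (complex R).

(* As [v /\ x = 0] iff the form [v] vanishes on tuples orthogonal to [x], these are
   the [v] such that [v /\ x = 0] for every [x] in [S]. *)
Definition vanishing (k : nat) (S : set 'rV[C]_n) : set (kvec k) :=
  [set v | ext_power setT v /\
    forall x, S x -> forall f, (forall a, pairing (f a) x = 0) -> v f = 0].

Lemma vanishing_lin (k : nat) S c (v w : @kvec R n k) :
  vanishing S v -> vanishing S w -> vanishing S (c *: v + w).
Proof.
move=> [v1 v2] [w1 w2]; split=> [|x Sx f fx]; first exact: lspan_lin.
by rewrite -[LHS]/(c * v f + w f) (v2 x)// (w2 x)// mulr0 addr0.
Qed.

Lemma vanishing0 (k : nat) S : vanishing S (0 : @kvec R n k).
Proof. by split=> //; exact: lspan0. Qed.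

Lemma decomposable_row0 (k : nat) (x : 'I_k -> 'rV[C]_n) f (a : 'I_k) :
  (forall b, pairing (f b) (x a) = 0) -> decomposable x f = 0.
Proof. by move=> fx; apply: (det_row0 (a := a)) => b; rewrite mxE. Qed.

Lemma ext_power_decomposable (k : nat) (L : set 'rV[C]_n) (x : 'I_k -> 'rV[C]_n) :
  (forall a, L (x a)) -> ext_power L (decomposable x).
Proof. by move=> Lx; apply: sub_lspan; exists x. Qed.

(** The matrix of the right-hand side is the one of [x] stacked on the one of [y]; Laplace expansion
    of its determinant is the definition of [wedge]. *)
Lemma wedge_decomposable (p q : nat) (x : 'I_p -> 'rV[C]_n) (y : 'I_q -> 'rV[C]_n) :
  wedge (decomposable x) (decomposable y) =
    decomposable (fun a => match fintype.split a with inl b => x b | inr b => y b end).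
Proof.
apply/funext => f; rewrite /wedge.
pose P := \matrix_(a < p, b < p + q) pairing (f b) (x a).
pose Q := \matrix_(a < q, b < p + q) pairing (f b) (y a).
have -> : decomposable (fun a => match fintype.split a with inl b => x b | inr b => y b end) f =
    \det (col_mx P Q).
  apply: (congr1 determinant); apply/matrixP => a b; rewrite !mxE.
  by case: (fintype.split a) => a'; rewrite mxE.
have nz : (p`! * q`!)%:R != 0 :> C by rewrite pnatr_eq0 -lt0n muln_gt0 !fact_gt0.
rewrite -[RHS](mulKf nz) -laplace_perm; apply: (congr1 (fun z => _ * z)).
apply: eq_bigr => s _.
apply: (f_equal2 (fun y z : C => (-1) ^+ s * y * z)); apply: (congr1 determinant);
  by apply/matrixP => a b; rewrite !mxE.
Qed.

Section LeadingRows.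
Variables (k p : nat) (B : 'M[C]_n).
Hypotheses (uB : B \in unitmx) (le_pn : (p <= n)%N).

Let leading : set 'rV[C]_n := [set row l B | l in [set l : 'I_n | (l < p)%N]].

(** If [i] missed [l], the dual vectors in the tuple would all be orthogonal to row [l], and the
    coefficient would vanish. *)
Lemma vanishing_coef (v : kvec k) (i : 'I_k -> 'I_n) : vanishing leading v ->
  v (fun a => col (i a) (invmx B)) != 0 ->
  forall l : 'I_n, (l < p)%N -> exists a, i a = l.
Proof.
move=> [_ vl] vi l lp; apply: contrapT => /forallNP il.
move/eqP: vi; apply; apply: (vl (row l B)) => [|a]; first by exists l.
by rewrite pairing_dual_basis//; case: eqP => // e; case: (il a).
Qed.

(** Pigeonhole: a nonzero coefficient would have to place [p] leading rows in [k] slots. *)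
Lemma vanishing_leading_gt (v : kvec k) : (k < p)%N -> vanishing leading v -> v = 0.
Proof.
move=> kp vP; rewrite (ext_power_expand uB vP.1) big1 ?scaler0// => i _.
have [->|/(vanishing_coef vP) il] := eqVneq (v (fun a => col (i a) (invmx B))) 0.
  exact: scale0r.
have /boolp.choice[a aP] : forall l : 'I_p, exists a, i a = widen_ord le_pn l.
  by move=> l; apply: il => /=.
have ainj : injective a.
  move=> l l' all; apply: val_inj.
  by have /(congr1 val) := congr1 i all; rewrite !aP.
by have := leq_card a ainj; rewrite !card_ord leqNgt kp.
Qed.

End LeadingRows.

Section LeadingBasis.
Variables (p q : nat) (B : 'M[C]_n).
Hypotheses (uB : B \in unitmx) (le_pn : (p <= n)%N).

Let leading : set 'rV[C]_n := [set row l B | l in [set l : 'I_n | (l < p)%N]].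

(** Only monomials that contain all leading rows survive in the expansion of [v], and each of them
    equals, up to a sign, the chosen representative of its index set. *)
Lemma vanishing_leading_basis :
  exists G : 'I_('C(n - p, q)) -> 'I_(p + q) -> 'I_n,
  let b e := decomposable (fun a => row (G e a) B) in
  [/\ forall e (a : 'I_p), G e (lshift q a) = a :> nat,
      forall c : 'I_('C(n - p, q)) -> C, \sum_e c e *: b e = 0 -> forall e, c e = 0
    & vanishing leading = lspan (range b)].
Proof.
have [G [Gl Ginj Gsurj Gsep]] := subset_transversal q le_pn.
exists G; split=> //.
- move=> c c0 e.
  (* Evaluating on the dual tuple of [G e] gives 1 for [b e]; any other [b e'] has a row whose index
     is not in [G e], hence a zero row of pairings. *)
  have := congr1 (@^~ (fun a => col (G e a) (invmx B))) c0.
  rewrite fct_sumE (bigD1 e)//= big1 => [|e' ee'].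
    rewrite addr0 -[X in X = _]/(c e * decomposable _ _).
    rewrite [decomposable _ _](_ : _ = 1) ?mulr1 // -(det1 C (p + q)).
    apply: (congr1 determinant); apply/matrixP => a b; rewrite !mxE.
    by rewrite pairing_dual_basis// (inj_eq (@Ginj e)).
  rewrite -[LHS]/(c e' * decomposable _ _); have [a Ga] := Gsep e' e ee'.
  rewrite (@decomposable_row0 _ _ _ a) ?mulr0// => b.
  by rewrite pairing_dual_basis// (negPf (Ga b)).
apply/seteqP; split=> v.
  move=> vP; rewrite (ext_power_expand uB vP.1) scaler_sumr.
  apply: lspan_sum => i.
  have [->|/(vanishing_coef uB vP) il] := eqVneq (v (fun a => col (i a) (invmx B))) 0.
    by rewrite scale0r; exact: lspan0.
  rewrite -[_ *: _]addr0; apply: lspan_lin; last exact: lspan0.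
  have [/injectiveP iinj|ninj] := boolP (injectiveb i); last first.
    rewrite /decomposable wedgev_eq0; first exact: lspan0.
    apply: contra ninj => /injectiveP rinj; apply/injectiveP => a b iab.
    by apply: rinj; apply/funext => f; rewrite iab.
  have [e [s sE]] := Gsurj i iinj il.
  have -> : decomposable (fun a => row (i a) B) =
      (-1) ^+ s *: decomposable (fun a => row (G e a) B).
    apply/funext => f; rewrite -[RHS]/(_ * decomposable _ f).
    rewrite (_ : decomposable (fun a => row (G e a) B) f =
        (-1) ^+ s * decomposable (fun a => row (i a) B) f).
      by rewrite mulrA -expr2 sqrr_sign mul1r.
    rewrite /decomposable -wedgev_perm; congr (wedgev _ f).
    by apply/funext => a; rewrite sE.
  rewrite -[_ *: _]addr0; apply: lspan_lin; last exact: lspan0.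
  by apply: sub_lspan; exists e.
move: v; apply: lspan_sub => [_ [e _ <-]||c v w]; last exact: vanishing_lin.
  split=> [|_ [l /= lp <-] f fl]; first exact: ext_power_decomposable.
  apply: (@decomposable_row0 _ _ _ (lshift q (Ordinal lp))) => b.
  by rewrite (_ : G e _ = l)//; apply: val_inj; rewrite /= Gl.
exact: vanishing0.
Qed.

End LeadingBasis.

End Vanishing.

(** Gaussian elimination writes [A] as [col_ebase A] times [[1 0]] times [row_ebase A]. Enlarging
    the left factor by an identity block completes [A] to an invertible matrix. *)
Lemma complete_row_free (K : fieldType) (p n : nat) (A : 'M[K]_(p, n)) : row_free A ->
  exists2 B : 'M[K]_n, B \in unitmx &
    forall (l : 'I_p) (j : 'I_n), j = l :> nat -> row j B = row l A.
Proof.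
move=> Afree; have [q qE] : exists q, n = (p + q)%N.
  by exists (n - p)%N; rewrite subnKC// -(eqP Afree) rank_leq_col.
subst n; have colA : col_ebase A \in unitmx by exact: col_ebase_unit.
exists (block_mx (col_ebase A) 0 0 1%:M *m row_ebase A).
  rewrite unitmx_mul row_ebase_unit andbT unitmxE det_ublock det1 mulr1.
  by rewrite -unitmxE.
move=> l j jl; have -> : j = lshift q l by exact: val_inj.
rewrite -row_usubmx; congr (row l _).
rewrite -mul_usub_mx block_mxEv col_mxKu -[RHS]mulmx_ebase (eqP Afree).
congr (_ *m _); rewrite (_ : pid_mx p = row_mx 1%:M 0) ?mul_mx_row ?mulmx1 ?mulmx0//.
apply/matrixP => a b; rewrite !mxE -[b in LHS]splitK.
case: (fintype.split b) => c; rewrite mxE /= ltn_ord andbT//.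
by rewrite ltn_eqF// (leq_trans (ltn_ord a)) ?leq_addr.
Qed.

(** The leading rows are taken among the rows of [G] themselves, so that a vanishing condition along
    the rows of [G] applies to them directly. *)
Lemma adapted_basis (K : fieldType) (m n : nat) (G : 'M[K]_(m, n)) :
  exists2 B : 'M[K]_n, B \in unitmx &
    forall l : 'I_n, (l < \rank G)%N -> exists i, row l B = row i G.
Proof.
have Afree : row_free (rowsub (maxrankfun G) G) by exact: maxrowsub_free.
have [B uB BE] := complete_row_free Afree; exists B => // l lr.
by exists (maxrankfun G (Ordinal lr)); rewrite (BE (Ordinal lr))// row_rowsub.
Qed.

(** * Divisibility by a top exterior power *)

Section TopWedge.
Context {R : realType} {n : nat}.
Local Notation C := (complex R).

Lemma wedge_ext_power (p q : nat) (L M : set 'rV[C]_n) (v : @kvec R n p) (w : @kvec R n q) :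
  ext_power L v -> ext_power M w ->
  exists (d : nat) (c : 'I_d -> C) (x : 'I_d -> 'I_p -> 'rV[C]_n)
      (y : 'I_d -> 'I_q -> 'rV[C]_n),
    (forall e a, L (x e a)) /\
    wedge v w = \sum_e c e *: wedge (decomposable (x e)) (decomposable (y e)).
Proof.
move=> /ext_powerE[d [c [x [Lx vE]]]] /ext_powerE[d' [c' [y [_ wE]]]].
pose I := ('I_d * 'I_d')%type.
exists #|{: I}|, (fun e => c (enum_val e).1 * c' (enum_val e).2),
  (fun e => x (enum_val e).1), (fun e => y (enum_val e).2); split=> // {Lx}.
rewrite -(big_enum_val (A := {: I})
  (fun e => (c e.1 * c' e.2) *: wedge (decomposable (x e.1)) (decomposable (y e.2)))).
rewrite -(pair_bigA _ (fun e e' =>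
   (c e * c' e') *: wedge (decomposable (x e)) (decomposable (y e')))) /=.
apply/funext => f; rewrite /wedge fct_sumE.
under [RHS]eq_bigr => e _ do rewrite fct_sumE.
under [in LHS]eq_bigr => s _.
  rewrite vE wE -mulrA mulr_suml mulr_sumr.
  under eq_bigr => e _ do rewrite mulr_sumr mulr_sumr.
  over.
rewrite mulr_sumr.
under [in LHS]eq_bigr => s _.
  rewrite mulr_sumr; under eq_bigr => e _ do rewrite mulr_sumr.
  over.
rewrite exchange_big; apply: eq_bigr => e _ /=.
rewrite exchange_big; apply: eq_bigr => e' _ /=.
rewrite -[RHS]/((c e * c' e') * (_ * _)) mulrCA mulr_sumr mulr_sumr.
apply: eq_bigr => s _; apply: (congr1 (fun z => _ * z)).
by rewrite (mulrACA (c e)) (mulrCA ((-1) ^+ s)) (mulrA ((-1) ^+ s)).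
Qed.

Variables (m : nat) (G : 'M[C]_(m, n)).
Let p := \rank G.
Let S : set 'rV[C]_n := [set row i G | i in setT].

(** Every tuple is orthogonal to a zero row, so such a row would reduce [vanishing S] to zero
    without changing the row space. *)
Hypothesis G0 : forall i, row i G != 0.

(** On a tuple orthogonal to a row of [G], some nontrivial combination of the first [p] rows of the
    matrix of pairings is zero, so its determinant vanishes. *)
Lemma decomposable_vanishing (q : nat) (x : 'I_p -> 'rV[C]_n) (y : 'I_q -> 'rV[C]_n) :
  (forall a, lspan S (x a)) -> vanishing S (wedge (decomposable x) (decomposable y)).
Proof.
rewrite /S lspan_rows => xL; rewrite wedge_decomposable.
split=> [|_ [i _ <-] f fG]; first exact: ext_power_decomposable.
pose X := \matrix_a x a.
(* If the [x a] are independent they span the row space of [G] by dimension, and [D] expresses the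
   nonzero row [i]; otherwise [D] is a linear relation among them. *)
have [D D0 DX] : exists2 D : 'rV[C]_p, D != 0 & forall b, D *m X *m f b = 0.
  have [Xfree|] := boolP (row_free X).
    have XG : (X <= G)%MS by apply/row_subP => a; rewrite rowK; exact: xL.
    have GX : (G <= X)%MS by rewrite -(geq_leqif (mxrank_leqif_sup XG)) (eqP Xfree).
    have /submxP[D DE] := submx_trans (row_sub i G) GX.
    exists D => [|b].
      by apply: contraNneq (G0 i) => D0; rewrite DE D0 mul0mx.
    apply/matrixP => ? ?; rewrite !ord1 -DE [RHS]mxE; exact: fG.
  rewrite -kermx_eq0 => /rowV0Pn[D /sub_kermxP DX D0].
  by exists D => // b; rewrite DX mul0mx.
apply/eqP/det0P; exists (row_mx D 0).
  by apply: contraNneq D0 => /(congr1 lsubmx); rewrite row_mxKl raddf0 => ->.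
apply/rowP => b; rewrite mxE [RHS]mxE big_split_ord /= [X in _ + X]big1 ?addr0.
  have /matrixP/(_ 0 0) := DX b; rewrite -mulmxA mxE [RHS]mxE => DXb; rewrite -[RHS]DXb.
  apply: eq_bigr => a _; rewrite row_mxEl mxE (unsplitK (inl a)); congr (_ * _).
  by rewrite /pairing !mxE; apply: eq_bigr => j _; rewrite mxE.
by move=> a _; rewrite row_mxEr [X in X * _]mxE mul0r.
Qed.

(** Vanishing along the [p] leading rows already gives divisibility by their product, and a multiple
    of that product vanishes along every row of [G]. So [S] and the leading rows impose the same
    conditions. *)
Lemma vanishing_wedge_basis (q : nat) :
  exists (x : 'I_('C(n - p, q)) -> 'I_p -> 'rV[C]_n)
      (y : 'I_('C(n - p, q)) -> 'I_q -> 'rV[C]_n),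
  let b e := wedge (decomposable (x e)) (decomposable (y e)) in
  [/\ forall e a, S (x e a),
      forall c : 'I_('C(n - p, q)) -> C, \sum_e c e *: b e = 0 -> forall e, c e = 0
    & vanishing S = lspan (range b)].
Proof.
have [B uB BG] := adapted_basis G.
have le_pn : (p <= n)%N := rank_leq_col G.
have [H [Hl Hfree HE]] := vanishing_leading_basis q uB le_pn.
have HS e (a : 'I_p) : S (row (H e (lshift q a)) B).
  have [|i ->] := BG (H e (lshift q a)); first by rewrite Hl; exact: ltn_ord.
  by exists i.
have wedgeE : (fun e => wedge (decomposable (fun a => row (H e (lshift q a)) B))
    (decomposable (fun a => row (H e (rshift p a)) B))) =
    (fun e => decomposable (fun a => row (H e a) B)).
  apply/funext => e; rewrite wedge_decomposable; congr wedgev; apply/funext => a.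
  by rewrite -[in RHS](splitK a); case: (fintype.split a).
exists (fun e a => row (H e (lshift q a)) B), (fun e a => row (H e (rshift p a)) B).
rewrite /= wedgeE; split=> //.
  move=> c c0; apply: Hfree.
  by rewrite -[RHS]c0; apply: eq_bigr => e _; rewrite -(congr1 (@^~ e) wedgeE).
apply/seteqP; split=> v; last first.
  rewrite -wedgeE; move: v; apply: lspan_sub => [_ [e _ <-]||c v w].
  - by apply: decomposable_vanishing => // a; apply: sub_lspan.
  - exact: vanishing0.
  - exact: vanishing_lin.
rewrite -HE => -[vE vS]; split=> // _ [l /= /BG[i ->] <-].
by apply: vS; exists i.
Qed.

Lemma vanishing_gt_rank (k : nat) : (k < p)%N -> vanishing S = [set (0 : @kvec R n k)].
Proof.
move=> kp; apply/seteqP; split=> [v [vE vS]|_ ->]; last exact: vanishing0.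
have [B uB BG] := adapted_basis G.
apply: (vanishing_leading_gt uB (rank_leq_col G) kp).
by split=> // _ [l /= /BG[i ->] <-]; apply: vS; exists i.
Qed.

Lemma top_wedge_vanishing (k : nat) :
  lspan [set x : @kvec R n k | exists (q : nat) (e : (p + q)%N = k) v w,
    [/\ ext_power (lspan S) v, ext_power setT w & x = kvec_cast e (wedge v w)]] =
  vanishing S.
Proof.
have castE q (v : @kvec R n (p + q)) : kvec_cast erefl v = v.
  by apply/funext => f; congr (v _); apply/funext => a; rewrite cast_ord_id.
apply/seteqP; split.
  apply: lspan_sub => [_ [q [e [v [w [vL wT ->]]]]]||]; last 2 first.
  - exact: vanishing0.
  - by move=> c x y; exact: vanishing_lin.
  subst k; rewrite castE.
  have [d [c [x [y [xL ->]]]]] := wedge_ext_power vL wT.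
  elim/big_rec: _ => [|e z _ zS]; first exact: vanishing0.
  by apply: vanishing_lin => //; apply: decomposable_vanishing.
have [pk|kp] := leqP p k; last first.
  by rewrite vanishing_gt_rank// => _ ->; exact: lspan0.
have [q kE] : exists q, k = (p + q)%N by exists (k - p)%N; rewrite subnKC.
subst k; have [x [y [xS _ ->]]] := vanishing_wedge_basis q.
apply: lspan_sub => [_ [e _ <-]||c v w]; last 2 first.
- exact: lspan0.
- exact: lspan_lin.
apply: sub_lspan; exists q, erefl, (decomposable (x e)), (decomposable (y e)).
split; [|exact: ext_power_decomposable|by rewrite castE].
by apply: ext_power_decomposable => a; apply: sub_lspan.
Qed.

Lemma has_dim_vanishing (k : nat) :
  has_dim (@vanishing R n k S) (if (p <= k)%N then 'C(n - p, k - p) else 0%N).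
Proof.
have [pk|kp] := leqP p k; last first.
  rewrite vanishing_gt_rank//; exists (fun=> 0); split=> [c _ []//|].
  apply/seteqP; split=> [_ ->|]; first exact: lspan0.
  apply: lspan_sub => [x [e _ <-] //|//|c x y /= -> ->].
  by rewrite scaler0 addr0.
have [q kE] : exists q, k = (p + q)%N by exists (k - p)%N; rewrite subnKC.
subst k; rewrite addKn; have [x [y [_ bfree bE]]] := vanishing_wedge_basis q.
by exists (fun e => wedge (decomposable (x e)) (decomposable (y e))).
Qed.

End TopWedge.

(** * The pairing and unimodular bases *)

Section Pairing.
Variables (K : comPzRingType) (n : nat).
Implicit Types (u : 'cV[K]_n) (x : 'rV[K]_n).

Lemma pairing_linr u c x y : pairing u (c *: x + y) = c * pairing u x + pairing u y.
Proof. by rewrite /pairing mulmxDl -scalemxAl !mxE. Qed.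

Lemma pairing_linl u v c x : pairing (c *: u + v) x = c * pairing u x + pairing v x.
Proof. by rewrite /pairing mulmxDr -scalemxAr !mxE. Qed.

Lemma pairing0r u : pairing u 0 = 0.
Proof. by rewrite /pairing mul0mx mxE. Qed.

Lemma pairing0l x : pairing 0 x = 0.
Proof. by rewrite /pairing mulmx0 mxE. Qed.

Lemma pairingDl u v x : pairing (u + v) x = pairing u x + pairing v x.
Proof. by rewrite -[u]scale1r pairing_linl mul1r scale1r. Qed.

Lemma pairingNl u x : pairing (- u) x = - pairing u x.
Proof. by rewrite -[- u]addr0 -scaleN1r pairing_linl pairing0l addr0 mulN1r. Qed.

Lemma pairing_sumr u (I : Type) (r : seq I) (P : pred I) (F : I -> 'rV[K]_n) :
  pairing u (\sum_(i <- r | P i) F i) = \sum_(i <- r | P i) pairing u (F i).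
Proof.
elim/big_ind2: _ => [|x x' y y' <- <-|//]; first exact: pairing0r.
by rewrite -[x in x + _]scale1r pairing_linr mul1r.
Qed.

Lemma pairing_suml x (I : Type) (r : seq I) (P : pred I) (F : I -> 'cV[K]_n) :
  pairing (\sum_(i <- r | P i) F i) x = \sum_(i <- r | P i) pairing (F i) x.
Proof.
elim/big_ind2: _ => [|u u' v v' <- <-|//]; first exact: pairing0l.
exact: pairingDl.
Qed.

Lemma pairingZr u c x : pairing u (c *: x) = c * pairing u x.
Proof. by rewrite -[c *: x]addr0 pairing_linr pairing0r addr0. Qed.

End Pairing.

Lemma pairing_map (K K' : comPzRingType) (f : {rmorphism K -> K'}) (n : nat)
    (u : 'cV[K]_n) (x : 'rV[K]_n) :
  pairing (map_mx f u) (map_mx f x) = f (pairing u x).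
Proof. by rewrite /pairing -map_mxM mxE. Qed.

Lemma dual_basis_expand (K : comUnitRingType) (n : nat) (B : 'M[K]_n) (x : 'rV[K]_n) :
  B \in unitmx -> x = \sum_j pairing (col j (invmx B)) x *: row j B.
Proof.
move=> uB; rewrite -{1}[x](mulmxKV uB) mulmx_sum_row; apply: eq_bigr => j _.
by rewrite /pairing colE mulmxA -colE [in RHS]mxE.
Qed.

Section UnimodularBasis.
Variables (K : comPzRingType) (n : nat) (B : 'M[int]_n).
Hypothesis uB : B \in unitmx.

(** The scalars are left open because one integral basis serves twice: over the reals for cones and
    over the complex numbers for vector fields. *)
Definition brow (i : 'I_n) : 'rV[K]_n := map_mx intr (row i B).
Definition bdual (i : 'I_n) : 'cV[K]_n := map_mx intr (col i (invmx B)).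

Lemma pairing_brow (i j : 'I_n) : pairing (bdual j) (brow i) = (i == j)%:R.
Proof. by rewrite pairing_map pairing_dual_basis// rmorph_nat. Qed.

Lemma brow_expand (x : 'rV[K]_n) : x = \sum_j pairing (bdual j) x *: brow j.
Proof.
have e : map_mx intr (invmx B) *m map_mx intr B = 1%:M :> 'M[K]_n.
  by rewrite -map_mxM mulVmx// map_mx1.
rewrite -[LHS]mulmx1 -e mulmxA mulmx_sum_row; apply: eq_bigr => j _.
by rewrite -map_row /pairing /bdual map_col colE mulmxA -colE [in RHS]mxE.
Qed.

End UnimodularBasis.

(** * Smooth cones in coordinates *)

Section SmoothCones.
Context {R : realType} {n : nat}.
Implicit Types (I J : {set 'I_n}) (B : 'M[int]_n).

Definition bcone B I : set 'rV[R]_n :=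
  cone_hull [set map_mx intr (row i B) | i in [set` I]].

Lemma bconeP B I x : B \in unitmx ->
  bcone B I x <-> forall j, if j \in I then is_true (0 <= pairing (bdual R B j) x)
                            else pairing (bdual R B j) x = 0.
Proof.
move=> uB; split=> [[d [c [a [ca ->]]]] j|xI].
  rewrite pairing_sumr; case: ifP => jI.
    apply: sumr_ge0 => l _; rewrite pairingZr; have [c0 [i _ <-]] := ca l.
    by rewrite mulr_ge0// pairing_brow// ler0n.
  apply: big1 => l _; rewrite pairingZr; have [c0 [i /= iI <-]] := ca l.
  by rewrite pairing_brow//; case: eqP jI => [<-|]; rewrite ?iI// mulr0.
exists #|I|, (fun e => pairing (bdual R B (enum_val e)) x), (fun e => brow R B (enum_val e)).
split=> [e|].
  split; last by exists (enum_val e) => //=; exact: enum_valP.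
  by have := xI (enum_val e); rewrite enum_valP.
rewrite -(big_enum_val (fun i => pairing (bdual R B i) x *: brow R B i)).
rewrite [LHS](brow_expand uB) [RHS]big_mkcond; apply: eq_bigr => j _.
by have := xI j; case: ifP => // _ ->; rewrite scale0r.
Qed.

Lemma brow_bcone B I i : i \in I -> bcone B I (brow R B i).
Proof.
move=> iI; exists 1%N, (fun=> 1), (fun=> brow R B i); split=> [_|].
  by split=> //; exists i.
by rewrite big_ord1 scale1r.
Qed.

(** The sum of the dual vectors of the discarded rows is nonnegative on the cone and vanishes
    exactly where each summand does. *)
Lemma bcone_face B I J : B \in unitmx -> J \subset I -> cone_face (bcone B J) (bcone B I).
Proof.
move=> uB JI; exists (\sum_(j in I | j \notin J) bdual R B j) => [x xI|].
  rewrite pairing_suml; apply: sumr_ge0 => j /andP[jI _].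
  by have /(bconeP _ _ uB)/(_ j) := xI; rewrite jI.
apply/seteqP; split=> x.
  move/(bconeP _ _ uB) => xJ; split.
    apply/bconeP => // j; have := xJ j; have [jJ|jJ] := boolP (j \in J).
      by rewrite (fintype.subsetP JI).
    by move=> ->; rewrite lexx; case: ifP.
  by rewrite /= pairing_suml big1// => j /andP[_ jJ]; have := xJ j; rewrite (negPf jJ).
case=> /(bconeP _ _ uB) xI /=; rewrite pairing_suml => x0.
have {}x0 j : j \in I -> j \notin J -> pairing (bdual R B j) x = 0.
  move=> jI jJ; apply: (psumr_eq0P _ x0); last by rewrite jI.
  by move=> l /andP[lI _]; have := xI l; rewrite lI.
apply/bconeP => // j; have := xI j.
have [jJ|jJ] := boolP (j \in J); first by rewrite (fintype.subsetP JI).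
by case: ifP => // jI _; exact: x0.
Qed.

Lemma has_dim_bcone B I : B \in unitmx -> has_dim (lspan (bcone B I)) #|I|.
Proof.
move=> uB; exists (fun e => brow R B (enum_val e)); split=> [c c0 e|].
  have := congr1 (pairing (bdual R B (enum_val e))) c0.
  rewrite pairing0r pairing_sumr (bigD1 e)//= big1 => [|e' ee'].
    by rewrite pairingZr pairing_brow// eqxx mulr1 addr0.
  by rewrite pairingZr pairing_brow// (inj_eq enum_val_inj) (negPf ee') mulr0.
apply/seteqP; split.
  apply: lspan_sub => [x [d [c [a [ca ->]]]]||c x y]; last 2 first.
  - exact: lspan0.
  - exact: lspan_lin.
  apply: lspan_sum => l; have [_ [i /= iI <-]] := ca l.
  by apply: sub_lspan; exists (enum_rank_in iI i) => //; rewrite enum_rankK_in.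
apply: lspan_sub => [_ [e _ <-]||c x y]; last 2 first.
- exact: lspan0.
- exact: lspan_lin.
by apply: sub_lspan; apply: brow_bcone; exact: enum_valP.
Qed.

(** Some integral form takes the value 1 on the row, so any integer factor of the row divides 1. *)
Lemma primitive_row B i : B \in unitmx -> primitive (row i B).
Proof.
move=> uB; have e : pairing (col i (invmx B)) (row i B) = 1.
  by rewrite pairing_dual_basis// eqxx.
split=> [|d w rw].
  by apply: contra_eq_neq e => ->; rewrite pairing0r eq_sym oner_eq0.
have : d \is a GRing.unit.
  by apply/unitrPr; exists (pairing (col i (invmx B)) w); rewrite -pairingZr -rw e.
by case/orP=> /eqP ->.
Qed.

(** [ray_gen] is a choice, so uniqueness is the point: another primitive generator is a nonnegative
    integral multiple of the row, and primitivity forces the multiple to be 1. *)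
Lemma ray_gen_bcone B i : B \in unitmx -> ray_gen (bcone B [set i]%SET) = row i B.
Proof.
move=> uB; rewrite /ray_gen.
have hullE : bcone B [set i]%SET = cone_hull [set map_mx intr (row i B)].
  congr cone_hull; apply/seteqP; split=> [_ [j /= + <-]|_ ->].
    by rewrite inE => /eqP ->.
  by exists i => //=; rewrite inE.
case: xgetP => [v _ [[v0 vprim] vE]|/(_ (row i B))]; last first.
  by case; split=> //; exact: primitive_row.
have /(bconeP _ _ uB) vc : bcone B [set i]%SET (map_mx intr v).
  rewrite vE; exists 1%N, (fun=> 1), (fun=> map_mx intr v).
  by split=> [_|]; [split|rewrite big_ord1 scale1r].
have vZ : v = pairing (col i (invmx B)) v *: row i B.
  rewrite {1}(dual_basis_expand v uB) (bigD1 i)//= big1 ?addr0// => j ji.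
  have := vc j; rewrite inE (negPf ji) pairing_map => /eqP.
  by rewrite intr_eq0 => /eqP ->; rewrite scale0r.
have := vc i; rewrite inE eqxx pairing_map ler0z => vi0.
by rewrite vZ -[pairing _ _]ger0_norm// (vprim _ _ vZ) scale1r.
Qed.

End SmoothCones.

(** * Active rays and faces of the polytope *)

Section FanRays.
Context {R : realType} {n : nat}.
Variable Delta : set (set 'rV[R]_n).
Hypothesis smoothDelta : smooth_fan Delta.

Lemma fan_bcone sigma : Delta sigma ->
  exists (B : 'M[int]_n) (I : {set 'I_n}), B \in unitmx /\ sigma = bcone B I.
Proof. by move=> /smoothDelta.2. Qed.

Lemma fan_face sigma tau : Delta sigma -> cone_face tau sigma -> Delta tau.
Proof. by case: smoothDelta => -[_ _ H _] _; exact: H. Qed.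

(** Completeness puts [0] in some cone of the fan; the empty set of its generators spans a face of
    that cone. *)
Lemma fan_zero_cone : complete_fan Delta -> Delta [set 0].
Proof.
move=> cD; have [sigma Ds _] : (\bigcup_(sigma in Delta) sigma) 0 by rewrite cD.
have [B [I [uB sE]]] := fan_bcone Ds.
rewrite (_ : [set 0] = bcone B (finset.set0)); last first.
  apply/seteqP; split=> x.
    by move=> ->; apply/bconeP => // j; rewrite inE pairing0r.
  move=> /(bconeP _ _ uB) x0; rewrite [x](brow_expand uB) big1// => j _.
  by have := x0 j; rewrite inE => ->; rewrite scale0r.
by apply: fan_face Ds _; rewrite sE; apply: bcone_face => //; exact: finset.sub0set.
Qed.

Lemma fan_ray (B : 'M[int]_n) (I : {set 'I_n}) i : B \in unitmx -> Delta (bcone B I) ->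
  i \in I -> rays Delta (bcone B [set i]%SET).
Proof.
move=> uB DI iI; split; last first.
  by have := has_dim_bcone (R := R) [set i]%SET uB; rewrite cards1.
by apply: fan_face DI _; apply: bcone_face => //; rewrite finset.sub1set.
Qed.

Lemma ray_bcone rho : rays Delta rho ->
  exists (B : 'M[int]_n) i, [/\ B \in unitmx, rho = bcone B [set i]%SET & ray_gen rho = row i B].
Proof.
case=> /fan_bcone[B [I [uB ->]]] dim1; exists B.
have : #|I| = 1%N.
  have := has_dim_bcone (R := R) I uB; move: dim1.
  by move=> /has_dim_rowsP[M Mfree ->] /has_dim_submx ->; apply/eqP.
by move=> /eqP/finset.cards1P[i ->]; exists i; rewrite ray_gen_bcone.
Qed.

Lemma ray_gens_seq (A : set (set 'rV[R]_n)) : A `<=` Delta ->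
  exists s : seq 'rV[int]_n, ray_gen @` A = [set` s].
Proof.
move=> AD; apply/finite_seqP/finite_image.
by apply: sub_finite_set AD _; case: smoothDelta => -[].
Qed.

Definition active (u : 'cV[int]_n) : set (set 'rV[R]_n) :=
  [set rho | rays Delta rho /\ pairing u (ray_gen rho) = -1].

(** Such a matrix turns both [i(u)] and the codimension of the face of [u] into ranks. *)
Lemma active_gens (u : 'cV[int]_n) : exists (m : nat) (G : 'M[int]_(m, n)),
  ray_gen @` active u = [set row i G | i in setT].
Proof.
have [|s sE] := @ray_gens_seq (active u); first by move=> rho [[]].
exists (size s), (\matrix_(i < size s) s`_i); rewrite sE; apply/seteqP; split=> v /=.
  move=> vs; have vi : (index v s < size s)%N by rewrite index_mem.
  by exists (Ordinal vi); rewrite // rowK nth_index.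
by case=> i _ <-; rewrite rowK mem_nth.
Qed.

Lemma polytope_int (u : 'cV[int]_n) : polytope Delta (map_mx intr u) <->
  forall rho, rays Delta rho -> -1 <= pairing u (ray_gen rho).
Proof.
by split=> uP rho /uP; rewrite pairing_map -(ler_int R) rmorphN1.
Qed.

Lemma small_pairing (s : seq 'rV[int]_n) : exists2 e : R, 0 < e &
  forall w : 'cV[R]_n, (forall j, `|w j 0| < e) ->
    forall v, v \in s -> -1 <= pairing w (map_mx intr v).
Proof.
elim: s => [|v s [e e0 IH]]; first by exists 1.
(* [c] bounds the pairing of [v] with vectors of sup norm 1, and the added 1 keeps it positive even
   for [v = 0]; entries below [c^-1] thus keep the pairing within [[-1, 1]]. *)
pose c : R := 1 + \sum_j `|(v 0 j)%:~R|.
have c0 : 0 < c by rewrite ltr_pwDl// sumr_ge0.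
exists (Num.min e c^-1) => [|w we v'].
  by rewrite lt_min e0 invr_gt0.
rewrite inE => /predU1P[->|]; last first.
  by apply: IH => j; have := we j; rewrite lt_min => /andP[].
apply: le_trans (_ : - `|pairing w (map_mx intr v)| <= _); last first.
  by rewrite lerNl ler_normr lexx orbT.
rewrite lerN2 /pairing mxE; apply: le_trans (ler_norm_sum _ _ _) _.
apply: le_trans (_ : \sum_j `|(v 0 j)%:~R| * c^-1 <= _).
  apply: ler_sum => j _; rewrite normrM mxE ler_wpM2l//.
  by have := we j; rewrite lt_min => /andP[_ /ltW].
by rewrite -mulr_suml ler_pdivrMr// mul1r /c lerDr.
Qed.

Lemma small_scale (e : R) (w : 'cV[R]_n) : 0 < e ->
  exists2 t : R, 0 < t & forall j, `|(t *: w) j 0| < e.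
Proof.
move=> e0; pose c : R := 1 + \sum_j `|w j 0|.
have c0 : 0 < c by rewrite ltr_pwDl// sumr_ge0.
(* [c] exceeds every [|w j 0|] strictly. *)
exists (e / c) => [|j]; first by rewrite divr_gt0.
rewrite mxE normrM gtr0_norm ?divr_gt0// -mulrA gtr_pMr// mulrC ltr_pdivrMr// mul1r.
by rewrite /c (bigD1 j)//= addrCA ltrDl ltr_pwDl// sumr_ge0.
Qed.

Let orth (u : 'cV[int]_n) : set 'cV[R]_n :=
  [set w | forall rho, active u rho -> pairing w (map_mx intr (ray_gen rho)) = 0].

Lemma orth_lin u c x y : orth u x -> orth u y -> orth u (c *: x + y).
Proof.
by move=> ux uy rho ur; rewrite pairing_linl ux// uy// mulr0 addr0.
Qed.

Lemma orth0 u : orth u 0.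
Proof. by move=> rho _; rewrite pairing0l. Qed.

(** Active inequalities do not change along [orth u]. An inactive one has an integral value above
    -1, hence at least 0, which leaves slack 1 for a small displacement. *)
Lemma polytope_near (u : 'cV[int]_n) : polytope Delta (map_mx intr u) ->
  exists2 e : R, 0 < e & forall w, orth u w -> (forall j, `|w j 0| < e) ->
    polytope Delta (map_mx intr u + w).
Proof.
move=> uP; have [|s sE] := @ray_gens_seq (rays Delta); first by move=> rho [].
have [e e0 es] := small_pairing s; exists e => // w uw we rho rrho.
rewrite pairingDl pairing_map.
have [/eqP u1|u1] := boolP (pairing u (ray_gen rho) == -1).
  by rewrite uw// addr0 u1 rmorphN1.
have u0 : 0 <= pairing u (ray_gen rho).
  have := (polytope_int u).1 uP rho rrho; rewrite le_eqVlt eq_sym (negPf u1) /=.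
  by case: (pairing _ _) => // -[].
rewrite -[-1]add0r lerD ?ler0z//; apply: es => //.
by have : [set` s] (ray_gen rho) by rewrite -sE; exists rho.
Qed.

Lemma relint_dirsp (u : 'cV[int]_n) F : poly_face F (polytope Delta) ->
  relint F (map_mx intr u) -> dirsp F = orth u.
Proof.
move=> [_ [x [b [Pb FE]]]] [Fu [e1 e10 Fe]].
have uP : polytope Delta (map_mx intr u) by move: Fu; rewrite FE => -[].
have [e0 e00 Pe] := polytope_near uP.
apply/seteqP; split=> w.
  (* Since [u] is in the relative interior, the segment from [p] to [u] extends beyond [u] within
     [F]; the inequality of [rho] at the new point is the opposite inequality at [p]. *)
  have F1 p rho : F p -> active u rho -> pairing p (map_mx intr (ray_gen rho)) = -1.
    move=> Fp [rrho u1]; pose d := map_mx intr u - p.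
    have [t t0 td] := small_scale d e10.
    have : F (map_mx intr u + t *: d).
      apply: Fe => [|j]; last by have := td j; rewrite !mxE addrAC subrr add0r.
      rewrite addrC addKr -[_ *: _]addr0.
      apply: lspan_lin; last exact: lspan0.
      by apply: sub_lspan; exists (map_mx intr u, p).
    rewrite FE => -[/(_ _ rrho) + _].
    have : polytope Delta p by move: Fp; rewrite FE => -[].
    move=> /(_ _ rrho) p1.
    rewrite addrC pairing_linl pairingDl pairingNl pairing_map u1 rmorphN1.
    rewrite -subr_ge0 opprK addrNK pmulr_rge0// -opprD oppr_ge0 => p2.
    by apply/eqP; rewrite eq_le p1 -subr_le0 opprK addrC p2.
  move: w; apply: lspan_sub => [_ [[p q] [/= Fp Fq] <-]||c w w']; last 2 first.
  - exact: orth0.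
  - exact: orth_lin.
  by move=> rho urho; rewrite pairingDl pairingNl !F1// subrr.
(* Both [u + t w] and [u - t w] lie in the polytope, and the form [x] defining [F] is minimal at
   [u], so [x] is constant along [w]. *)
move=> uw; have [t t0 tw] := small_scale w e00.
have Pt : polytope Delta (map_mx intr u + t *: w).
  by apply: Pe => //; rewrite -[_ *: _]addr0; apply: orth_lin => //; exact: orth0.
have Pt' : polytope Delta (map_mx intr u - t *: w).
  apply: Pe => [|j]; last by rewrite mxE normrN.
  by rewrite -scaleNr -[_ *: _]addr0; apply: orth_lin => //; exact: orth0.
have ub : pairing (map_mx intr u) x = b by move: Fu; rewrite FE => -[].
have tw0 : pairing (t *: w) x = 0.
  have := Pb _ Pt; have := Pb _ Pt'; rewrite !pairingDl pairingNl ub.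
  rewrite !lerDl oppr_ge0 => p0 p1; by apply/eqP; rewrite eq_le p0 p1.
have Ft : F (map_mx intr u + t *: w) by rewrite FE; split=> //=; rewrite pairingDl tw0 addr0.
have -> : w = t^-1 *: (map_mx intr u + t *: w - map_mx intr u) + 0.
  by rewrite addr0 addrC addKr scalerA mulVf ?scale1r// gt_eqF.
apply: lspan_lin; last exact: lspan0.
by apply: sub_lspan; exists (map_mx intr u + t *: w, map_mx intr u).
Qed.

(** The supporting form is the sum of the active generators: its [m] summands are at least -1, so it
    reaches [-m] exactly where all active inequalities are equalities. With no active ray this is
    the whole polytope. *)
Lemma polytope_face (u : 'cV[int]_n) : polytope Delta (map_mx intr u) ->
  exists2 F, poly_face F (polytope Delta) & relint F (map_mx intr u).
Proof.
move=> uP; have [m [G GE]] := active_gens u.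
pose x : 'rV[R]_n := \sum_i map_mx intr (row i G).
pose F := polytope Delta `&` [set w | pairing w x = - m%:R].
have Gact i : exists2 rho, active u rho & ray_gen rho = row i G.
  by have : (ray_gen @` active u) (row i G) by rewrite GE; exists i.
have xE w : pairing w x + m%:R = \sum_i (pairing w (map_mx intr (row i G)) + 1).
  by rewrite big_split /= -pairing_sumr sumr_const card_ord.
have Pge0 w i : polytope Delta w -> 0 <= pairing w (map_mx intr (row i G)) + 1.
  have [rho [rrho _] <-] := Gact i; move=> /(_ _ rrho).
  by rewrite -subr_ge0 opprK.
have Fu : F (map_mx intr u).
  split=> //=; apply/eqP; rewrite -subr_eq0 opprK xE; apply/eqP/big1 => i _.
  by have [rho [_ u1] <-] := Gact i; rewrite pairing_map u1 rmorphN1 addNr.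
have dirF : dirsp F `<=` orth u.
  apply: lspan_sub => [_ [[p q] [/= Fp Fq] <-]||c w w']; last 2 first.
  - exact: orth0.
  - exact: orth_lin.
  suff F1 w rho : F w -> active u rho -> pairing w (map_mx intr (ray_gen rho)) = -1.
    by move=> rho urho; rewrite pairingDl pairingNl !F1// subrr.
  case=> Pw /= /eqP; rewrite -subr_eq0 opprK xE => /eqP w0 urho.
  have : (ray_gen @` active u) (ray_gen rho) by exists rho.
  rewrite GE => -[i _ <-]; apply/eqP; rewrite -subr_eq0 opprK; apply/eqP.
  by apply: (psumr_eq0P _ w0) => // j _; exact: Pge0.
exists F.
  split; first by exists (map_mx intr u).
  exists x, (- m%:R); split=> // w Pw.
  by rewrite -subr_ge0 opprK xE sumr_ge0// => i _; exact: Pge0.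
split=> //; have [e e0 Pe] := polytope_near uP; exists e => // w wF we.
have -> : w = map_mx intr u + (w - map_mx intr u) by rewrite addrC subrK.
split; first by apply: Pe; [exact: dirF|by move=> j; have := we j; rewrite !mxE].
rewrite /= pairingDl Fu.2 -[RHS]addr0; congr (_ + _).
rewrite pairing_sumr big1// => i _; have [rho urho <-] := Gact i.
exact: dirF.
Qed.

Lemma orth_ker u (m : nat) (G : 'M[int]_(m, n)) :
  ray_gen @` active u = [set row i G | i in setT] ->
  orth u = [set w | map_mx intr G *m w = 0].
Proof.
move=> GE; apply/seteqP; split=> w uw /=.
  apply/matrixP => i j; rewrite ord1 [RHS]mxE.
  have [rho urho rE] : (ray_gen @` active u) (row i G) by rewrite GE; exists i.
  by rewrite -[RHS](uw _ urho) rE /pairing map_row -row_mul [RHS]mxE.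
move=> rho urho.
have : (ray_gen @` active u) (ray_gen rho) by exists rho.
by rewrite GE => -[i _ <-]; rewrite /pairing map_row -row_mul uw !mxE.
Qed.

Lemma Sface_rank (i : nat) u (m : nat) (G : 'M[int]_(m, n)) :
  ray_gen @` active u = [set row i G | i in setT] ->
  Sface Delta i u <->
    polytope Delta (map_mx intr u) /\ i = \rank (map_mx intr G : 'M[R]_(m, n)).
Proof.
move=> /orth_ker GE; have rn := rank_leq_col (map_mx intr G : 'M[R]_(m, n)).
split=> [[F [Ff [d + di] Fu]]|[/polytope_face[F Ff Fu] ->]].
  rewrite (relint_dirsp Ff Fu) GE => /has_dim_ker dE; split.
    by case: Ff Fu => _ [x [b [_ ->]]] [[]].
  by rewrite -(subKn rn) -dE -di addKn.
exists F; split=> //; exists (n - \rank (map_mx intr G : 'M[R]_(m, n)))%N.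
  by rewrite (relint_dirsp Ff Fu) GE; apply/has_dim_ker.
by rewrite subnK.
Qed.

End FanRays.

(** * The spaces N_u^k and their dimensions *)

Section FanNu.
Context {R : realType} {n : nat}.
Local Notation C := (complex R).
Variable Delta : set (set 'rV[R]_n).
Hypothesis smoothDelta : smooth_fan Delta.

Definition active_vectors (u : 'cV[int]_n) : set 'rV[C]_n :=
  [set map_mx intr (ray_gen rho) | rho in active Delta u].

Lemma active_vectors_rows u (m : nat) (G : 'M[int]_(m, n)) :
  ray_gen @` active Delta u = [set row i G | i in setT] ->
  active_vectors u = [set row i (map_mx intr G) | i in setT].
Proof.
move=> GE; apply/seteqP; split=> _ [y yP <-].
  have : (ray_gen @` active Delta u) (ray_gen y) by exists y.
  by rewrite GE => -[i _ <-]; exists i; rewrite // map_row.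
have : [set row i G | i in setT] (row y G) by exists y.
by rewrite -GE => -[rho urho rE]; exists rho => //; rewrite -map_row rE.
Qed.

Lemma active_row_neq0 u (m : nat) (G : 'M[int]_(m, n)) :
  ray_gen @` active Delta u = [set row i G | i in setT] ->
  forall i, row i (map_mx intr G : 'M[C]_(m, n)) != 0.
Proof.
move=> GE i; have : [set row i G | i in setT] (row i G) by exists i.
rewrite -GE -map_row => -[rho [rrho _] <-].
have [B [j [uB _ ->]]] := ray_bcone smoothDelta rrho.
have e := pairing_brow C uB j j.
apply: contra_eq_neq e; rewrite /brow => ->.
by rewrite pairing0r eqxx eq_sym oner_eq0.
Qed.

(** [i(u)] is a rank over the complex numbers and the codimension of a face is one over the
    reals. *)
Lemma rank_intr (m : nat) (G : 'M[int]_(m, n)) :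
  \rank (map_mx intr G : 'M[C]_(m, n)) = \rank (map_mx intr G : 'M[R]_(m, n)).
Proof.
rewrite -(mxrank_map (real_complex R)) -map_mx_comp; congr (\rank _).
by apply/matrixP => i j; rewrite !mxE /= rmorph_int.
Qed.

Lemma NuE (k : nat) u : Nu Delta k u = vanishing (active_vectors u).
Proof.
have [m [G GE]] := active_gens smoothDelta u.
rewrite (active_vectors_rows GE) -(top_wedge_vanishing (active_row_neq0 GE)) /Nu.
have LE : Lu Delta u = lspan [set row i (map_mx intr G) | i in setT].
  by rewrite -(active_vectors_rows GE).
have -> : vdim (Lu Delta u) = \rank (map_mx intr G : 'M[C]_(m, n)).
  rewrite /vdim LE lspan_rows; apply: xget_subset1; first exact/has_dim_submx.
  by move=> d d' /has_dim_submx -> /has_dim_submx ->.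
by rewrite LE.
Qed.

Lemma has_dim_Nu (k i : nat) u : Sface Delta i u ->
  has_dim (Nu Delta k u) (if (i <= k)%N then 'C(n - i, k - i) else 0%N).
Proof.
have [m [G GE]] := active_gens smoothDelta u.
move=> /(Sface_rank smoothDelta i GE)[_ ->]; rewrite NuE (active_vectors_rows GE) -rank_intr.
exact: has_dim_vanishing (active_row_neq0 GE) k.
Qed.

(** For [i(u) > k] the space has dimension 0, so a nonzero element bounds the codimension by [k]. *)
Lemma Sface_le_Nu (k : nat) u v : polytope Delta (map_mx intr u) ->
  Nu Delta k u v -> v != 0 -> Sface_le Delta k u.
Proof.
have [m [G GE]] := active_gens smoothDelta u.
move=> uP vN v0; have := (Sface_rank smoothDelta _ GE).2 (conj uP erefl).
set i := \rank _ => ui; exists i => //=; rewrite leqNgt; apply: contra v0 => ki.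
have [b [_ NE]] := has_dim_Nu k ui; move: b NE vN; rewrite leqNgt ki /= => b ->.
by case=> [[|d] [c [a [aP ->]]]]; [rewrite big_ord0|case: (aP ord0) => -[]].
Qed.

Lemma Sface_polytope k u : Sface_le Delta k u -> polytope Delta (map_mx intr u).
Proof.
have [m [G GE]] := active_gens smoothDelta u.
by case=> i _ /(Sface_rank smoothDelta _ GE)[].
Qed.

End FanNu.

(** * Derivations and polyvector fields on the torus *)

Section RegularFunctions.
Context {R : realType} {n : nat}.
Local Notation C := (complex R).
Variable sigma : set 'rV[R]_n.

Lemma regfun_scalerAl (c : C) (f g : regfun sigma) : c *: (f * g) = c *: f * g.
Proof.
by apply: val_inj; apply/funext => t; rewrite -[LHS]/(c * (f t * g t)) mulrA.
Qed.

(** Constants as a ring morphism, so that a complex determinant can be moved into the ring of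
    regular functions. *)
Definition regcst (c : C) : regfun sigma := c *: (1 : regfun sigma).

Fact regcst_zmod_morphism : zmod_morphism regcst.
Proof. by move=> c d; rewrite /regcst scalerBl. Qed.

Fact regcst_monoid_morphism : monoid_morphism regcst.
Proof.
by split=> [|c d]; rewrite /regcst ?scale1r// -regfun_scalerAl mul1r scalerA.
Qed.

HB.instance Definition _ := GRing.isZmodMorphism.Build C (regfun sigma) regcst
  regcst_zmod_morphism.
HB.instance Definition _ := GRing.isMonoidMorphism.Build C (regfun sigma) regcst
  regcst_monoid_morphism.

Lemma regcstM (c : C) (f : regfun sigma) : regcst c * f = c *: f.
Proof. by rewrite /regcst -regfun_scalerAl mul1r. Qed.

End RegularFunctions.

Section Laurent.
Context {R : realType} {n : nat}.
Local Notation C := (complex R).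
Local Notation A := (@regfunT R n).
Implicit Types (u m : 'cV[int]_n) (x : 'rV[C]_n).

Lemma chi_neq0 u (t : @torus R n) : chi u t != 0.
Proof. by apply/prodf_neq0 => i _; rewrite expfz_neq0 ?tcoord_neq0. Qed.

Lemma chiT0 : chiT 0 = 1 :> A.
Proof. by apply: val_inj; exact: chi0. Qed.

Lemma chiTD u m : chiT (u + m) = chiT u * chiT m :> A.
Proof. by apply: val_inj; exact: chiD. Qed.

Lemma chiT_sum (I : Type) (r : seq I) (P : pred I) (F : I -> 'cV[int]_n) :
  chiT (\sum_(i <- r | P i) F i) = \prod_(i <- r | P i) chiT (F i) :> A.
Proof. by elim/big_ind2: _ => [|u a v b <- <-|//]; rewrite ?chiT0 ?chiTD. Qed.

Lemma regfunT_linear_ext (D D' : A -> A) :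
  (forall (c : C) f g, D (c *: f + g) = c *: D f + D g) ->
  (forall (c : C) f g, D' (c *: f + g) = c *: D' f + D' g) ->
  (forall u, D (chiT u) = D' (chiT u)) -> D =1 D'.
Proof.
move=> Dl D'l DD' f; have [s ->] := laurentP f.
rewrite /laurent; elim: s => [|p s IH]; first by rewrite big_nil !linear_at0.
by rewrite big_cons Dl D'l IH DD'.
Qed.

Lemma rhoN_lin x (c : C) f g : rhoN x (c *: f + g) = c *: rhoN x f + rhoN x g.
Proof. by have [[]] := rhoNP x. Qed.

Lemma rhoN_chi x u : rhoN x (chiT u) = pairing (map_mx intr u) x *: chiT u.
Proof. by have [_] := rhoNP x. Qed.

Lemma rhoN_sum (I : Type) (r : seq I) (c : I -> C) (x : I -> 'rV[C]_n) f :
  rhoN (\sum_(i <- r) c i *: x i) f = \sum_(i <- r) c i *: rhoN (x i) f.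
Proof.
move: f; apply: regfunT_linear_ext; first exact: rhoN_lin.
  move=> d f g; rewrite scaler_sumr -big_split; apply: eq_bigr => i _ /=.
  by rewrite rhoN_lin scalerDr !scalerA mulrC.
move=> u; rewrite rhoN_chi pairing_sumr scaler_suml.
by apply: eq_bigr => i _; rewrite rhoN_chi pairingZr scalerA.
Qed.

Lemma rhoN_delta x f : rhoN x f = \sum_j regcst [set 0] (x 0 j) * rhoN (delta_mx 0 j) f.
Proof.
rewrite {1}[x](row_sum_delta) rhoN_sum.
by apply: eq_bigr => j _; rewrite regcstM.
Qed.

(* [D chi^u = logder D u * chi^u], the inverse of the unit [chi^u] being [chi^(-u)]. *)
Definition logder (D : A -> A) u : A := chiT (- u) * D (chiT u).

(** The Leibniz rule makes [logder D] additive in the exponent, so it is determined by the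
    coordinate characters. This is why a derivation has only [n] free coefficients. *)
Lemma logder_sum (D : A -> A) u : derivation D ->
  logder D u = \sum_j logder D (delta_mx j 0) *~ u j 0.
Proof.
move=> [_ DM].
have chiK m : chiT (- m) * chiT m = 1 :> A by rewrite -chiTD addNr chiT0.
have LD m m' : logder D (m + m') = logder D m + logder D m'.
  rewrite /logder opprD !chiTD DM.
  rewrite -[RHS](_ : chiT (- m) * D (chiT m) * (chiT (- m') * chiT m') +
    (chiT (- m) * chiT m) * (chiT (- m') * D (chiT m')) = _); last first.
    by rewrite !chiK mulr1 mul1r.
  by move: (D _) (D _) => p q; ring.
have L0 : logder D 0 = 0 by have := LD 0 0; rewrite addr0 -[X in X = _]addr0 => /addrI.
pose L : {additive 'cV[int]_n -> A} :=
  HB.pack (logder D) (GRing.isNmodMorphism.Build _ _ (logder D) (conj L0 LD)).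
have -> : logder D u = L u by [].
have {1}-> : u = \sum_j delta_mx j 0 *~ u j 0.
  apply/matrixP => i j; rewrite ord1 summxE (bigD1 i)//= big1 => [|l li].
    by rewrite -scaler_int !mxE intz !eqxx mulr1 addr0.
  by rewrite -scaler_int !mxE eq_sym (negPf li) mulr0.
by rewrite raddf_sum; apply: eq_bigr => j _; rewrite raddfMz.
Qed.

End Laurent.

Section PolyvectorsOnTorus.
Context {R : realType} {n : nat}.
Local Notation C := (complex R).
Local Notation A := (@regfunT R n).
Implicit Types (u m : 'cV[int]_n) (x : 'rV[C]_n).

Lemma pairing_delta (K : comPzRingType) (u : 'cV[K]_n) j : pairing u (delta_mx 0 j) = u j 0.
Proof. by rewrite /pairing -rowE mxE. Qed.

Lemma derivationE (D : A -> A) f : derivation D ->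
  D f = \sum_j logder D (delta_mx j 0) * rhoN (delta_mx 0 j) f.
Proof.
move=> dD; move: f; apply: regfunT_linear_ext; first exact: dD.1.
  move=> c f g; rewrite scaler_sumr -big_split; apply: eq_bigr => j _ /=.
  by rewrite rhoN_lin mulrDr mulrC -regfun_scalerAl mulrC.
move=> u; have -> : D (chiT u) = logder D u * chiT u.
  by rewrite /logder mulrAC -chiTD addNr chiT0 mul1r.
rewrite logder_sum// mulr_suml; apply: eq_bigr => j _.
rewrite rhoN_chi -regcstM mulrA; congr (_ * _).
by rewrite pairing_delta mxE rmorph_int mulrzr.
Qed.

Lemma wedgev_derivation (k : nat) (D : 'I_k -> A -> A) : (forall a, derivation (D a)) ->
  exists g : {ffun 'I_k -> 'I_n} -> A, forall f,
    wedgev D f = \sum_i g i * wedgev (fun a => rhoN (delta_mx 0 (i a))) f.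
Proof.
move=> dD; exists (fun i => \prod_a logder (D a) (delta_mx (i a) 0)) => f.
pose X := \matrix_(a < k, j < n) logder (D a) (delta_mx j 0).
pose P := \matrix_(j < n, b < k) rhoN (delta_mx 0 j) (f b).
transitivity (\det (X *m P)).
  congr (\det _); apply/matrixP => a b; rewrite !mxE derivationE//.
  by apply: eq_bigr => j _; rewrite !mxE.
rewrite det_mulmx_ffun; apply: eq_bigr => i _; congr (_ * _).
  by apply: eq_bigr => a _; rewrite mxE.
by congr (\det _); apply/matrixP => a b; rewrite !mxE.
Qed.

Lemma rhoNkE (k : nat) (v : @kvec R n k) f :
  rhoNk v f = (k`!%:R)^-1 *: \sum_(i : {ffun 'I_k -> 'I_n})
    v (fun a => delta_mx (i a) 0) *: wedgev (fun a => rhoN (delta_mx 0 (i a))) f.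
Proof. by rewrite /rhoNk -[LHS]/(_ *: _) fct_sumE. Qed.

Lemma rhoNk_lin (k : nat) (c : C) (v w : @kvec R n k) f :
  rhoNk (c *: v + w) f = c *: rhoNk v f + rhoNk w f.
Proof.
rewrite !rhoNkE [c *: (_ *: _)]scalerA [c * _]mulrC -scalerA -scalerDr.
congr (_ *: _); rewrite scaler_sumr -big_split; apply: eq_bigr => i _ /=.
by rewrite scalerA -scalerDl.
Qed.

(** By Cauchy-Binet the coordinate formula with its [1/k!] does not depend on the basis and is the
    exterior power of [rhoN]. *)
Lemma rhoNk_decomposable (k : nat) (x : 'I_k -> 'rV[C]_n) :
  rhoNk (decomposable x) = wedgev (fun a => rhoN (x a)).
Proof.
apply/funext => f; rewrite rhoNkE.
pose X := \matrix_(a < k) x a.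
pose P := \matrix_(j < n, b < k) rhoN (delta_mx 0 j) (f b).
have nz : k`!%:R != 0 :> C by rewrite pnatr_eq0 -lt0n fact_gt0.
transitivity (\det (map_mx (regcst [set 0]) X *m P)); last first.
  congr (\det _); apply/matrixP => a b; rewrite !mxE rhoN_delta.
  by apply: eq_bigr => j _; rewrite !mxE.
rewrite -unitfE in nz; apply: (canLR (scalerK nz)).
rewrite -regcstM rmorph_nat -cauchy_binet_ffun; apply: eq_bigr => i _.
rewrite -regcstM; congr (_ * _).
  rewrite -map_mxsub det_map_mx; congr (regcst _ (\det _)).
  by apply/matrixP => a b; rewrite !mxE /pairing -colE mxE.
by congr (\det _); apply/matrixP => a b; rewrite !mxE.
Qed.

(** Each column of the matrix is a constant column times one character, so the determinant splits
    off the product of the characters. *)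
Lemma wedgev_rhoN_chi (k : nat) (x : 'I_k -> 'rV[C]_n) (m : 'I_k -> 'cV[int]_n) :
  wedgev (fun a => rhoN (x a)) (fun a => chiT (m a)) =
    decomposable x (fun a => map_mx intr (m a)) *: chiT (\sum_a m a).
Proof.
pose Q := \matrix_(a < k, b < k) pairing (map_mx intr (m b)) (x a).
rewrite -regcstM -det_map_mx chiT_sum.
have -> : \prod_a chiT (m a) = \det (diag_mx (\row_a chiT (m a))) :> A.
  by rewrite det_diag; apply: eq_bigr => a _; rewrite mxE.
rewrite -det_mulmx; congr (\det _); apply/matrixP => a b.
by rewrite mul_mx_diag !mxE rhoN_chi regcstM.
Qed.

Lemma rhoNk_chi (k : nat) (v : @kvec R n k) (m : 'I_k -> 'cV[int]_n) :
  ext_power setT v ->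
  rhoNk v (fun a => chiT (m a)) = v (fun a => map_mx intr (m a)) *: chiT (\sum_a m a).
Proof.
move: v; apply: lspan_sub => [_ [x _ <-]||c v w vE wE].
- by rewrite -/(decomposable x) rhoNk_decomposable wedgev_rhoN_chi.
- rewrite rhoNkE big1 ?scaler0 => [|i _]; last exact: scale0r.
  by rewrite -[RHS]/(0 *: _) scale0r.
- by rewrite rhoNk_lin vE wE scalerA -scalerDl.
Qed.

Definition term (k : nat) u (v : @kvec R n k) : multimap [set 0] k :=
  fun f => chiT u * rhoNk v f.

Lemma term_lin (k : nat) u c (v w : @kvec R n k) :
  term u (c *: v + w) = c *: term u v + term u w.
Proof.
apply/funext => f; rewrite /term rhoNk_lin mulrDr mulrC -regfun_scalerAl.
by rewrite [rhoNk v f * _]mulrC.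
Qed.

Lemma term0 (k : nat) u : term u (0 : @kvec R n k) = 0.
Proof. by apply: linear_at0 => c v w; exact: term_lin. Qed.

Lemma polyvector_terms (k : nat) : polyvector [set 0] k `<=`
  lspan [set term p.1 p.2 | p in setT `*` @ext_power R n k setT].
Proof.
apply: lspan_sub => [_ [h [D [dD ->]]]||c s s']; last 2 first.
- exact: lspan0.
- exact: lspan_lin.
have [g gE] := wedgev_derivation dD.
pose e (i : {ffun 'I_k -> 'I_n}) := decomposable (fun a => delta_mx 0 (i a) : 'rV[C]_n).
have /boolp.choice[r rE] : forall i, exists r, h * g i = laurent r.
  by move=> i; exact: laurentP.
rewrite (_ : (fun f => _) = \sum_i 1 *: \sum_(p <- r i) p.1 *: term p.2 (e i)).
  apply: lspan_sum => i; apply: lspan_sum => p; apply: sub_lspan.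
  by exists (p.2, e i) => //; split=> //; exact: ext_power_decomposable.
apply/funext => f; rewrite fct_sumE gE mulr_sumr; apply: eq_bigr => i _.
rewrite mulrA rE /laurent scale1r fct_sumE mulr_suml; apply: eq_bigr => p _.
by rewrite -regfun_scalerAl -[RHS]/(_ *: (chiT _ * rhoNk _ f)) rhoNk_decomposable.
Qed.

End PolyvectorsOnTorus.

(** * Independence of terms with distinct exponents *)

Section Terms.
Context {R : realType} {n k : nat}.
Local Notation C := (complex R).
Implicit Types (u m : 'cV[int]_n) (v : @kvec R n k) (t : @torus R n).

Lemma term_sum (I : Type) (r : seq I) (P : pred I) u (c : I -> C) (v : I -> @kvec R n k) :
  term u (\sum_(i <- r | P i) c i *: v i) = \sum_(i <- r | P i) c i *: term u (v i).
Proof. by elim/big_rec2: _ => [|i w s _ <-]; rewrite ?term0 ?term_lin. Qed.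

Lemma collect_terms (s : multimap [set 0] k) :
  lspan [set term p.1 p.2 | p in setT `*` @ext_power R n k setT] s ->
  exists (r : seq 'cV[int]_n) (v : 'cV[int]_n -> @kvec R n k),
    [/\ uniq r, forall u, ext_power setT (v u) & s = \sum_(u <- r) term u (v u)].
Proof.
move=> [d [c [a [aP ->]]]].
have /boolp.choice[p pP] : forall i, exists p : 'cV[int]_n * @kvec R n k,
    ext_power setT p.2 /\ term p.1 p.2 = a i.
  by move=> i; have [p [_ pE] <-] := aP i; exists p.
exists (undup [seq (p i).1 | i <- index_enum 'I_d]),
  (fun u => \sum_(i | (p i).1 == u) c i *: (p i).2).
split; first exact: undup_uniq.
  by move=> u; apply: lspan_sum => i; exact: (pP i).1.
under [RHS]eq_bigr => u _ do rewrite term_sum.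
rewrite (exchange_big_dep xpredT)//=; apply: eq_bigr => i _.
rewrite -big_filter (@eq_filter _ _ (pred1 (p i).1)) => [|u]; last by rewrite /= eq_sym.
rewrite filter_pred1_uniq ?undup_uniq ?big_seq1 ?(pP i).2// mem_undup.
by apply: map_f; exact: mem_index_enum.
Qed.

Lemma ext_power_eq0 v : ext_power setT v ->
  (forall i : 'I_k -> 'I_n, v (fun a => delta_mx (i a) 0) = 0) -> v = 0.
Proof.
move=> vE v0; rewrite (ext_power_expand (unitmx1 _ _) vE) big1 ?scaler0// => i _.
rewrite (_ : (fun a => _) = (fun a => delta_mx (i a) 0)) ?v0 ?scale0r//.
by apply/funext => a; rewrite invmx1 colE mul1mx.
Qed.

Lemma sum_terms_chi (r : seq 'cV[int]_n) (v : 'cV[int]_n -> @kvec R n k)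
    (m : 'I_k -> 'cV[int]_n) t : (forall u, ext_power setT (v u)) ->
  regval ((\sum_(u <- r) term u (v u)) (fun a => chiT (m a))) t =
    \sum_(u <- r) v u (fun a => map_mx intr (m a)) * chi (u + \sum_a m a) t.
Proof.
move=> vE; rewrite fct_sumE -[regval _]/(val _) raddf_sum fct_sumE.
apply: eq_bigr => u _; rewrite /term rhoNk_chi//=.
by rewrite chiD -[LHS]/(chi u t * (_ * chi _ t)) mulrCA.
Qed.

(** On a tuple of coordinate characters all terms acquire the same nonvanishing factor
    [chi (\sum_a m a)]. After division by it, independence of characters gives one coefficient of
    each [v u] at a time. *)
Lemma terms_free (r : seq 'cV[int]_n) (v : 'cV[int]_n -> @kvec R n k) : uniq r ->
  (forall u, ext_power setT (v u)) -> \sum_(u <- r) term u (v u) = 0 ->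
  forall u, u \in r -> v u = 0.
Proof.
move=> ur vE s0 u ru; apply: ext_power_eq0 => // i.
pose m a : 'cV[int]_n := delta_mx (i a) 0.
have mE : (fun a => map_mx intr (m a)) = (fun a => delta_mx (i a) 0) :> ('I_k -> 'cV[C]_n).
  by apply/funext => a; rewrite map_delta_mx.
apply: (chi_free (c := fun u => v u (fun a => delta_mx (i a) 0)) ur _ ru) => t.
have := sum_terms_chi r m t vE; rewrite s0 mE => /esym/eqP.
under eq_bigr => w _ do rewrite chiD -[(chi _ * chi _) t]/(chi _ t * chi _ t) mulrA.
by rewrite -mulr_suml mulf_eq0 (negPf (chi_neq0 _ _)) orbF => /eqP.
Qed.

(** [f] also has an expansion with exponents in the dual cone. The difference of the two expansions
    has zero coefficients, so an exponent outside the dual cone cannot occur in the given one. *)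
Lemma regular_coef (sigma : set 'rV[R]_n) (r : seq 'cV[int]_n) (c : 'cV[int]_n -> C)
    (f : torus -> C) : uniq r -> f \in regular sigma ->
  (forall t, f t = \sum_(u <- r) c u * chi u t) ->
  forall u, u \in r -> c u != 0 -> dual_cone sigma (map_mx intr u).
Proof.
move=> ur /asboolP[d [b [a [aP fE]]]] fr u ru; apply: contraNP => nu.
have /boolp.choice[p pP] : forall i, exists w : 'cV[int]_n,
    dual_cone sigma (map_mx intr w) /\ chi w = a i.
  by move=> i; have [w ws <-] := aP i; exists w.
pose q := undup (r ++ [seq p i | i <- index_enum 'I_d]).
pose e w := (if w \in r then c w else 0) - \sum_(i | p i == w) b i.
suff e0 : e u = 0.
  move: e0; rewrite /e ru big1 ?subr0 => [->//|i /eqP pu].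
  by case: nu; rewrite -pu; exact: (pP i).1.
have uq : uniq q by exact: undup_uniq.
apply: (chi_free uq); last by rewrite mem_undup mem_cat ru.
move=> t; rewrite /e; under eq_bigr => w _ do rewrite mulrBl.
rewrite sumrB; apply/eqP; rewrite subr_eq0; apply/eqP.
transitivity (f t).
  rewrite fr [RHS](_ : _ = \sum_(w <- r) (if w \in r then c w else 0) * chi w t); last first.
    by rewrite [LHS]big_seq [RHS]big_seq; apply: eq_bigr => w ->.
  rewrite (bigID (mem r)) /= [X in _ + X]big1 ?addr0 => [|w /negPf ->]; last exact: mul0r.
  rewrite -big_filter; apply: perm_big; apply: uniq_perm => [||w]//.
    exact: filter_uniq.
  by rewrite mem_filter mem_undup mem_cat; case: (w \in r).
rewrite fE fct_sumE; under [RHS]eq_bigr => w _ do rewrite mulr_suml.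
rewrite (exchange_big_dep xpredT)//=; apply: eq_bigr => i _.
rewrite -big_filter (@eq_filter _ _ (pred1 (p i))) => [|w]; last by rewrite /= eq_sym.
rewrite filter_pred1_uniq// ?big_seq1 -?(pP i).2// mem_undup mem_cat.
by rewrite map_f ?orbT// mem_index_enum.
Qed.

End Terms.

(** * Torus action on terms *)

Section TorusAction.
Context {R : realType} {n k : nat}.
Local Notation C := (complex R).
Local Notation A := (@regfunT R n).
Implicit Types (u m : 'cV[int]_n) (v w : @kvec R n k) (t : @torus R n).

Lemma translate_lin (sigma : set 'rV[R]_n) t (c : C) (f g : regfun sigma) :
  translate t (c *: f + g) = c *: translate t f + translate t g.
Proof. exact: val_inj. Qed.

Lemma translate_chi t u : translate t (chiT u : A) = chi u t *: chiT u.
Proof. by apply: val_inj; apply/funext => p; exact: chi_tmul. Qed.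

Fact translate_zmod_morphism (sigma : set 'rV[R]_n) t : zmod_morphism (@translate R n sigma t).
Proof. by move=> f g; exact: val_inj. Qed.

Fact translate_monoid_morphism (sigma : set 'rV[R]_n) t :
  monoid_morphism (@translate R n sigma t).
Proof. by split=> [|f g]; exact: val_inj. Qed.

HB.instance Definition _ sigma t := GRing.isZmodMorphism.Build (regfun sigma) (regfun sigma)
  (@translate R n sigma t) (translate_zmod_morphism t).
HB.instance Definition _ sigma t := GRing.isMonoidMorphism.Build (regfun sigma) (regfun sigma)
  (@translate R n sigma t) (translate_monoid_morphism sigma t).

(** The fields [rhoN x] are invariant because they act on each character by a scalar, and so does a
    translation. *)
Lemma translate_rhoN t (x : 'rV[C]_n) f : rhoN x (translate t f) = translate t (rhoN x f).
Proof.
move: f; apply: regfunT_linear_ext => [c f g|c f g|u].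
- by rewrite translate_lin rhoN_lin.
- by rewrite rhoN_lin translate_lin.
have Z (D : A -> A) (c : C) f : (forall (c : C) f g, D (c *: f + g) = c *: D f + D g) ->
    D (c *: f) = c *: D f.
  by move=> Dl; rewrite -[c *: f]addr0 Dl (linear_at0 Dl) addr0.
rewrite translate_chi (Z (rhoN x)); last exact: rhoN_lin.
rewrite rhoN_chi (Z (translate t)); last exact: translate_lin.
by rewrite translate_chi !scalerA mulrC.
Qed.

Lemma translate_rhoNk t v (f : 'I_k -> A) :
  rhoNk v (fun a => translate t (f a)) = translate t (rhoNk v f).
Proof.
have Z (c : C) (g : A) : translate t (c *: g) = c *: translate t g by exact: val_inj.
rewrite !rhoNkE Z rmorph_sum; congr (_ *: _); apply: eq_bigr => i _ /=.
rewrite Z /wedgev -[translate t (\det _)]det_map_mx; congr (_ *: _).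
congr (\det _); apply/matrixP => a b.
by rewrite !mxE translate_rhoN.
Qed.

Lemma chi_tinv t u : chi u (tinv t) = chi (- u) t.
Proof. by apply: eq_bigr => i _; rewrite mxE exprz_inv. Qed.

Lemma translateK t : cancel (@translate R n [set 0] t) (translate (tinv t)).
Proof.
move=> f; have [s ->] := laurentP f; rewrite /laurent !rmorph_sum; apply: eq_bigr => p _ /=.
have Z t' (c : C) (g : A) : translate t' (c *: g) = c *: translate t' g by exact: val_inj.
rewrite !Z !translate_chi Z translate_chi chi_tinv; congr (_ *: _); rewrite scalerA.
have := congr1 (fun f => f t) (chiD p.2 (- p.2)); rewrite subrr chi0 => e.
by rewrite -[chi _ t * chi _ t]/((chi p.2 * chi (- p.2)) t) -e scale1r.
Qed.

Lemma torus_act_lin t (c : C) (s s' : multimap [set 0] k) :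
  torus_act t (c *: s + s') = c *: torus_act t s + torus_act t s'.
Proof. by apply/funext => f; rewrite /torus_act; exact: translate_lin. Qed.

(** Invariance of [rhoNk v] leaves only the factor [chi^u] to be translated, by the inverse of [t];
    hence the sign of the weight. *)
Lemma torus_act_term t u v : torus_act t (term u v) = chi (- u) t *: term u v.
Proof.
apply/funext => f; rewrite /torus_act /term translate_rhoNk rmorphM /= translateK.
by rewrite translate_chi chi_tinv -regfun_scalerAl.
Qed.

End TorusAction.

Lemma invmx_intr (K : comUnitRingType) (n : nat) (B : 'M[int]_n) : B \in unitmx ->
  map_mx intr B \in (unitmx : {pred 'M[K]_n}) /\
  invmx (map_mx intr B) = map_mx intr (invmx B) :> 'M[K]_n.
Proof.
move=> uB; have e : map_mx intr B *m map_mx intr (invmx B) = 1%:M :> 'M[K]_n.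
  by rewrite -map_mxM mulmxV// map_mx1.
have [uK _] := mulmx1_unit e; split=> //.
by rewrite -[LHS]mulmx1 -e mulmxA mulVmx// mul1mx.
Qed.

(** * Sections over affine charts *)

Section RegularValues.
Context {R : realType} {n : nat} {sigma : set 'rV[R]_n}.
Local Notation C := (complex R).

Lemma regular_restrict (f : regfun sigma) : regval f \in regular [set 0].
Proof.
have /asboolP[d [c [a [aP ->]]]] := regvalP f; apply/asboolP.
apply: lspan_sum => i; apply: sub_lspan; have [u _ <-] := aP i.
by exists u => // x ->; rewrite pairing0r.
Qed.

Lemma regval_lin (c : C) (f g : regfun sigma) :
  regval (c *: f + g) = c *: regval f + regval g.
Proof. by []. Qed.

Lemma regval_det (m : nat) (M : 'M[regfun sigma]_m) :
  regval (\det M) = \det (map_mx (@regval R n sigma) M).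
Proof. exact: esym (det_map_mx (\val : regfun sigma -> _) M). Qed.

Lemma regval_inj : injective (@regval R n sigma).
Proof. exact: val_inj. Qed.

Lemma regvalD (f g : regfun sigma) :
  regval (f + g) = regval f + regval g.
Proof. by []. Qed.

Lemma regvalM (f g : regfun sigma) :
  regval (f * g) = regval f * regval g.
Proof. by []. Qed.

Definition to_torus (f : regfun sigma) : regfunT := RegFun (regular_restrict f).

Lemma to_torus_lin (c : C) f g : to_torus (c *: f + g) = c *: to_torus f + to_torus g.
Proof. exact: val_inj. Qed.

Lemma to_torus_mul f g : to_torus (f * g) = to_torus f * to_torus g.
Proof. exact: val_inj. Qed.

End RegularValues.

Section LocalSections.
Context {R : realType} {n k : nat}.
Local Notation C := (complex R).
Local Notation A := (@regfunT R n).
Variables (B : 'M[int]_n) (I : {set 'I_n}).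
Hypothesis uB : B \in unitmx.
Local Notation sigma := (bcone B I : set 'rV[R]_n).

Lemma dual_bcone (u : 'cV[int]_n) :
  dual_cone sigma (map_mx intr u) <-> forall i, i \in I -> 0 <= pairing u (row i B).
Proof.
split=> [us i iI|uI x [d [c [a [ca ->]]]]].
  by have := us _ (brow_bcone B iI); rewrite pairing_map ler0z.
rewrite pairing_sumr sumr_ge0// => l _; rewrite pairingZr.
by have [c0 [i iI <-]] := ca l; rewrite pairing_map mulr_ge0// ler0z uI.
Qed.

Lemma dual_basis_col (j i : 'I_n) : pairing (col j (invmx B)) (row i B) = (i == j)%:R.
Proof. exact: pairing_dual_basis. Qed.

(** The factor in front lowers the [j]-th exponent by 1, which is harmless for a positive exponent;
    monomials with exponent 0 are killed by the derivation. *)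
Lemma regular_coord_deriv (j : 'I_n) (f : regfun sigma) :
  regval (chiT (- col j (invmx B)) * rhoN (brow C B j) (to_torus f)) \in regular sigma.
Proof.
have /asboolP[d [c [a [aP fE]]]] := regvalP f; apply/asboolP.
have /boolp.choice[p pP] : forall i, exists w : 'cV[int]_n,
    dual_cone sigma (map_mx intr w) /\ chi w = a i.
  by move=> i; have [w ws <-] := aP i; exists w.
have -> : to_torus f = \sum_i c i *: chiT (p i).
  apply: val_inj; rewrite raddf_sum /= fE; apply: eq_bigr => i _.
  by rewrite -(pP i).2.
have -> : rhoN (brow C B j) (\sum_i c i *: chiT (p i)) =
    \sum_i c i *: ((pairing (p i) (row j B))%:~R *: chiT (p i)).
  elim/big_rec2: _ => [|i y1 y2 _ <-]; last by rewrite rhoN_lin rhoN_chi pairing_map.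
  by apply: linear_at0 => c' f' g'; exact: rhoN_lin.
rewrite mulr_sumr.
under eq_bigr => i _ do rewrite mulrC -regfun_scalerAl -regfun_scalerAl -chiTD.
rewrite -[regval _]/(val _) raddf_sum /=.
apply: lspan_sum => i; have [p0|p0] := eqVneq (pairing (p i) (row j B)) 0.
  rewrite p0 (_ : _ *: _ = 0); first exact: lspan0.
  by apply/funext => t; rewrite -[LHS]/(0 * _) mul0r.
rewrite -[_ *: _]addr0; apply: lspan_lin; last exact: lspan0.
apply: sub_lspan; exists (p i - col j (invmx B)) => //; apply/dual_bcone => l lI.
have pl : 0 <= pairing (p i) (row l B) by apply: (dual_bcone (p i)).1 => //; exact: (pP i).1.
rewrite pairingDl pairingNl dual_basis_col.
have [e|] := eqVneq l j; last by rewrite subr0.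
by rewrite subr_ge0 -gtz0_ge1 lt_def pl andbT e.
Qed.

(* In the coordinates [chi^(b_j^* )] of [U_sigma], this is the partial derivative with
   respect to the [j]-th one. *)
Definition coord_deriv (j : 'I_n) (f : regfun sigma) : regfun sigma :=
  RegFun (regular_coord_deriv j f).

Lemma coord_derivE j f :
  regval (coord_deriv j f) = regval (chiT (- col j (invmx B)) * rhoN (brow C B j) (to_torus f)).
Proof. by []. Qed.

Lemma derivation_coord_deriv (j : 'I_n) : derivation (coord_deriv j).
Proof.
split=> [c f g|f g]; apply: regval_inj.
  rewrite regval_lin !coord_derivE -regval_lin to_torus_lin rhoN_lin.
  by rewrite mulrDr mulrC -regfun_scalerAl [rhoN _ (to_torus f) * _]mulrC.
rewrite regvalD (regvalM (coord_deriv j f)) (regvalM f) !coord_derivE.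
rewrite -[regval f]/(regval (to_torus f)) -[regval g]/(regval (to_torus g)).
rewrite -(regvalM _ (to_torus g)) -(regvalM (to_torus f)) -regvalD; congr regval.
by rewrite to_torus_mul (rhoNP _).1.2 mulrDr mulrA [in X in _ + X]mulrCA.
Qed.

(** In the basis [B] the term is a combination of wedges of coordinate derivatives with coefficients
    [chi (w i)]. Along row [l] the exponent is [<u, b_l>] plus the number of occurrences of [l] in
    [i]. It is negative only if [<u, b_l> = -1] and [l] does not occur, and then the last hypothesis
    makes [vb i] zero. *)
Lemma local_term (u : 'cV[int]_n) (v : @kvec R n k) : ext_power setT v ->
  (forall i, i \in I -> -1 <= pairing u (row i B)) ->
  (forall i, i \in I -> pairing u (row i B) = -1 ->
     forall f, (forall a, pairing (f a) (brow C B i) = 0) -> v f = 0) ->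
  exists2 S : multimap sigma k, polyvector sigma k S & restricts_to S (term u v).
Proof.
move=> vE u1 uv; 
pose vb (i : {ffun 'I_k -> 'I_n}) := v (fun a => map_mx intr (col (i a) (invmx B))).
pose w (i : {ffun 'I_k -> 'I_n}) := u + \sum_a col (i a) (invmx B).
(* When [vb i] is zero the character may fail to be regular, and [0] stands in for it. *)
have /boolp.choice[h hE] : forall i, exists h : regfun sigma,
    vb i != 0 -> regval h = chi (w i).
  move=> i; have [v0|v0] := eqVneq (vb i) 0; first by exists 0; rewrite ?v0 ?eqxx.
  suff wi : chi (w i) \in regular sigma by exists (RegFun wi).
  apply: regular_chi; apply/dual_bcone => l lI; rewrite pairingDl pairing_suml.
  have s0 : 0 <= \sum_a pairing (col (i a) (invmx B)) (row l B).
    by apply: sumr_ge0 => a _; rewrite dual_basis_col ler0n.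
  have [ul|ul] := eqVneq (pairing u (row l B)) (-1); last first.
    rewrite addr_ge0//; have := u1 l lI; rewrite le_eqVlt eq_sym (negPf ul) /=.
    by case: (pairing _ _) => // -[].
  have [a ia] : exists a, i a = l.
    apply: contrapT => /forallNP il; move/eqP: v0; apply; apply: (uv l lI ul) => a.
    by rewrite pairing_map dual_basis_col; case: eqP => // e; case: (il a).
  rewrite ul addrC subr_ge0 (bigD1 a)//= dual_basis_col ia eqxx lerDl.
  by apply: sumr_ge0 => c _; rewrite dual_basis_col ler0n.
have [uC iC] := invmx_intr C uB.
have tE : term u v = \sum_i (k`!%:R^-1 * vb i) *: term u (decomposable (fun a => brow C B (i a))).
  rewrite -term_sum; congr (term u _); rewrite {1}(ext_power_expand uC vE) scaler_sumr.
  apply: eq_bigr => i _; rewrite scalerA; congr (_ * _ *: decomposable _).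
    by rewrite /vb; congr v; apply/funext => a; rewrite iC map_col.
  by apply/funext => a; rewrite /brow map_row.
exists (\sum_i (k`!%:R^-1 * vb i) *:
    ((fun f => h i * wedgev (fun a => coord_deriv (i a)) f) : multimap sigma k)).
  apply: lspan_sum => i; apply: sub_lspan.
  exists (h i), (fun a => coord_deriv (i a)); split=> // a.
  exact: derivation_coord_deriv.
move=> f g fg; rewrite tE !fct_sumE -![regval _]/(val _) !raddf_sum.
apply: eq_bigr => i _ /=.
have [->|/hE hi] := eqVneq (vb i) 0.
  by apply/funext => t; rewrite -[LHS]/(_ * 0 * _) -[RHS]/(_ * 0 * _) !mulr0 !mul0r.
suff e : regval (h i * wedgev (fun a => coord_deriv (i a)) f) =
    regval (term u (decomposable (fun a => brow C B (i a))) g).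
  apply: (congr1 (fun F => _ *: F) e).
have gE b : g b = to_torus (f b) by apply: val_inj; rewrite /= fg.
pose P := \matrix_(a < k, b < k) rhoN (brow C B (i a)) (g b).
(* Row [a] of the matrix of coordinate derivatives is the row of the field [rhoN] divided by a
   coordinate; taken together, these factors turn [chi (w i)] back into [chi u]. *)
transitivity (regval (chiT (w i) * \det (diag_mx (\row_a chiT (- col (i a) (invmx B))) *m P))).
  rewrite (regvalM (h i)) hi (regvalM (chiT (w i))).
  apply: (congr1 (fun F => chi (w i) * F)).
  rewrite /wedgev !regval_det; congr (\det _); apply/matrixP => a b.
  rewrite mul_diag_mx !mxE; apply: etrans (coord_derivE _ _) _.
  by rewrite gE.
congr regval; rewrite det_mulmx det_diag mulrA /term rhoNk_decomposable; congr (_ * _).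
under eq_bigr => a _ do rewrite mxE.
by rewrite -chiT_sum -chiTD sumrN addrK.
Qed.

End LocalSections.

(** * Global sections and their decomposition *)

Section GlobalSections.
Context {R : realType} {n k : nat}.
Local Notation C := (complex R).
Local Notation kv := (@kvec R n k).
Implicit Types (u w : 'cV[int]_n) (s : @multimap R n [set 0] k).
Variable Delta : set (set 'rV[R]_n).
Hypotheses (smoothDelta : smooth_fan Delta) (completeDelta : complete_fan Delta).

(** Compatibility is automatic: local sections that all restrict to [s] agree on functions that
    agree on [T]. The zero cone belongs to the fan, and restriction to it recovers [s] itself. *)
Lemma H0_local s :
  (forall sigma, Delta sigma ->
     exists2 S : multimap sigma k, polyvector sigma k S & restricts_to S s) ->
  H0 Delta k s.
Proof.
move=> loc.
have locE sigma : exists S : multimap sigma k,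
    Delta sigma -> polyvector sigma k S /\ restricts_to S s.
  have [/loc[S S1 S2]|nD] := pselect (Delta sigma); first by exists S.
  by exists (fun _ => 0).
pose S sigma := sval (cid (locE sigma)).
have SP sigma : Delta sigma -> polyvector sigma k (S sigma) /\ restricts_to (S sigma) s.
  exact: svalP (cid (locE sigma)).
exists S; split=> [sigma /SP[]//|sigma tau Ds Dt _ f g fg|].
  rewrite ((SP _ Ds).2 f (fun a => to_torus (f a)))//.
  by rewrite ((SP _ Dt).2 g (fun a => to_torus (f a)))// => a; rewrite -fg.
apply/funext => f; apply: regval_inj.
by rewrite ((SP _ (fan_zero_cone smoothDelta completeDelta)).2 f f).
Qed.

Lemma H0_lin c s s' : H0 Delta k s -> H0 Delta k s' -> H0 Delta k (c *: s + s').
Proof.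
move=> [S [S1 S2 S3]] [T [T1 T2 T3]].
exists (fun sigma => c *: S sigma + T sigma); split.
- by move=> sigma Ds; apply: lspan_lin; [exact: S1|exact: T1].
- move=> sigma tau Ds Dt ts f g fg.
  rewrite -[LHS]/(regval (c *: S sigma f + T sigma f)) regval_lin.
  rewrite -[RHS]/(regval (c *: S tau g + T tau g)) regval_lin.
  by rewrite (S2 _ _ Ds Dt ts _ _ fg) (T2 _ _ Ds Dt ts _ _ fg).
- by rewrite S3 T3.
Qed.

Lemma H0_0 : H0 Delta k 0.
Proof.
exists (fun sigma => 0); split=> // sigma _; exact: lspan0.
Qed.

Lemma H0_term u (v : kv) : polytope Delta (map_mx intr u) -> Nu Delta k u v ->
  H0 Delta k (term u v).
Proof.
move=> /(polytope_int Delta) uP; rewrite (NuE smoothDelta) => -[vE vN].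
apply: H0_local => sigma Ds; have [B [I [uB sE]]] := fan_bcone smoothDelta Ds.
rewrite sE in Ds *; have ray := fan_ray smoothDelta uB Ds.
apply: local_term => // i iI.
  by rewrite -(ray_gen_bcone (R := R) i uB); apply: uP; exact: ray.
move=> ui; apply: vN; exists (bcone B [set i]%SET).
  by split; [exact: ray|rewrite ray_gen_bcone].
by rewrite ray_gen_bcone.
Qed.

(* [u] is the weight of a term [chi^u v] that is regular along the divisor of the ray
   spanned by the [l]-th row of [B]; the hypothesis is the absence of poles on tuples
   from the dual basis. *)
Lemma ray_condition (B : 'M[int]_n) (l : 'I_n) u (v : kv) : B \in unitmx ->
  ext_power setT v ->
  (forall i : 'I_k -> 'I_n, v (fun a => bdual C B (i a)) != 0 ->
     0 <= pairing u (row l B) + \sum_a (l == i a)%:R) ->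
  (v != 0 -> -1 <= pairing u (row l B)) /\
  (pairing u (row l B) = -1 ->
     forall f, (forall a, pairing (f a) (brow C B l) = 0) -> v f = 0).
Proof.
move=> uB vE v1; have [uC iC] := invmx_intr C uB.
have dualE (i : 'I_k -> 'I_n) :
    (fun a => col (i a) (invmx (map_mx intr B))) = (fun a => bdual C B (i a)).
  by apply/funext => a; rewrite iC /bdual map_col.
split=> [v0|ul f fl].
  (* Repeated indices contribute nothing, so a nonzero [v] has a nonzero coefficient on an injective
     tuple; such a tuple meets [l] at most once. *)
  have [i vi di] : exists2 i : {ffun 'I_k -> 'I_n}, v (fun a => bdual C B (i a)) != 0 &
      injective i.
    apply: contrapT => none; move/eqP: v0; apply.
    rewrite (ext_power_expand uC vE) big1 ?scaler0// => i _; rewrite dualE.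
    have [->|vi] := eqVneq (v (fun a => bdual C B (i a))) 0; first exact: scale0r.
    rewrite /decomposable wedgev_eq0 ?scaler0//; apply/negP => /injectiveP inj.
    apply: none; exists i => // a b iab; apply: inj; apply/funext => f.
    by rewrite iab.
  have := v1 i vi; rewrite -lerBlDr sub0r; apply: le_trans; rewrite lerN2.
  have [[a la]|none] := pselect (exists a, i a = l); last first.
    by rewrite big1// => a _; case: eqP => // la; case: none; exists a.
  by rewrite (bigD1 a)//= la eqxx big1 ?addr0// => b ba; rewrite -la (inj_eq di) eq_sym (negPf ba).
(* With [<u, b> = -1], every surviving monomial must contain row [l], hence vanishes on tuples
   orthogonal to it. *)
rewrite (ext_power_expandE f uC vE) big1 ?mulr0// => i _; rewrite dualE.
have [->|vi] := eqVneq (v (fun a => bdual C B (i a))) 0; first exact: mul0r.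
have [[a la]|none] := pselect (exists a, i a = l).
  by rewrite (decomposable_row0 (a := a)) ?mulr0// => b; rewrite la -map_row; exact: fl.
have := v1 i vi; rewrite ul big1 ?addr0 => [|a _]; first by rewrite lerNr oppr0 ler10.
by case: eqP => // la; case: none; exists a.
Qed.

(** On the chart of a ray, a tuple of regular characters must have a regular value. Its expansion
    contains every exponent of [r], shifted by the same [\sum_a m a]; the shifted exponents remain
    distinct, so [regular_coef] isolates that of [u]. *)
Lemma H0_coef (r : seq 'cV[int]_n) (v : 'cV[int]_n -> kv) : uniq r ->
  (forall u, ext_power setT (v u)) -> H0 Delta k (\sum_(u <- r) term u (v u)) ->
  forall u, u \in r -> v u != 0 -> polytope Delta (map_mx intr u) /\ Nu Delta k u (v u).
Proof.
move=> ur vE [S [_ S2 S0]] u ru v0.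
have D0 := fan_zero_cone smoothDelta completeDelta.
have key (B : 'M[int]_n) l (m : 'I_k -> 'cV[int]_n) : B \in unitmx ->
    Delta (bcone B [set l]%SET) -> (forall a, 0 <= pairing (m a) (row l B)) ->
    v u (fun a => map_mx intr (m a)) != 0 ->
    0 <= pairing u (row l B) + \sum_a pairing (m a) (row l B).
  move=> uB Dl m0 vm.
  have dm a : dual_cone (bcone B [set l]%SET : set 'rV[R]_n) (map_mx intr (m a)).
    by apply/dual_bcone => // i; rewrite inE => /eqP ->.
  have zl : [set (0 : 'rV[R]_n)] `<=` bcone B [set l]%SET.
    move=> _ ->; apply/bconeP => // j; by rewrite pairing0r lexx; case: ifP.
  have sE := S2 _ _ Dl D0 zl (fun a => RegFun (regular_chi (dm a))) (fun a => chiT (m a))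
    (fun a => erefl).
  pose c w := v (w - \sum_a m a) (fun a => map_mx intr (m a)).
  have H : dual_cone (bcone B [set l]%SET : set 'rV[R]_n) (map_mx intr (u + \sum_a m a)).
    apply: (regular_coef (r := [seq w + \sum_a m a | w <- r]) (c := c) _
      (regvalP (S _ (fun a => RegFun (regular_chi (dm a)))))).
    - rewrite map_inj_uniq//; exact: addIr.
    - move=> t; rewrite sE S0 sum_terms_chi// big_map.
      by apply: eq_bigr => w _; rewrite /c addrK.
    - by apply: map_f.
    - by rewrite /c addrK.
  have /dual_bcone/(_ l) := H; rewrite inE eqxx pairingDl pairing_suml; exact.
have cond (B : 'M[int]_n) l : B \in unitmx -> Delta (bcone B [set l]%SET) ->
    -1 <= pairing u (row l B) /\ (pairing u (row l B) = -1 ->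
     forall f, (forall a, pairing (f a) (brow C B l) = 0) -> v u f = 0).
  move=> uB Dl; have [|c1 c2] := ray_condition (l := l) (u := u) uB (vE u);
    last by split=> //; exact: c1.
  (* Dual vectors pair with the row to 0 or 1, so their characters are regular on this chart. *)
  move=> i vi; have := key B l (fun a => col (i a) (invmx B)) uB Dl _ vi.
  under eq_bigr => a _ do rewrite dual_basis_col//.
  by apply=> a; rewrite dual_basis_col// ler0n.
split.
  apply/polytope_int => rho rrho; have [B [l [uB rE ->]]] := ray_bcone smoothDelta rrho.
  by apply: (cond B l uB _).1; rewrite -rE; case: rrho.
rewrite (NuE smoothDelta); split=> // _ [rho [rrho u1] <-].
have [B [l [uB rE gE]]] := ray_bcone smoothDelta rrho; rewrite gE in u1 *.
by apply: (cond B l uB _).2 => //; rewrite -rE; case: rrho.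
Qed.

Lemma H0_terms s : H0 Delta k s ->
  exists (r : seq 'cV[int]_n) (v : 'cV[int]_n -> kv),
    [/\ uniq r, forall u, ext_power setT (v u) & s = \sum_(u <- r) term u (v u)].
Proof.
move=> [S [S1 _ <-]]; apply: collect_terms; apply: polyvector_terms; apply: S1.
exact: fan_zero_cone smoothDelta completeDelta.
Qed.

Lemma summands_direct : is_direct_sum (H0 Delta k) (Sface_le Delta k) (summand Delta k).
Proof.
split.
  apply/seteqP; split=> s.
    move=> Hs; have [r [v [ur vE sE]]] := H0_terms Hs; rewrite sE big_seq.
    elim/big_rec: _ => [|u x ru xS]; first exact: lspan0.
    have [->|v0] := eqVneq (v u) 0; first by rewrite term0 add0r.
    rewrite -[term u _]scale1r; apply: lspan_lin => //; apply: sub_lspan.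
    have [uP uN] : polytope Delta (map_mx intr u) /\ Nu Delta k u (v u).
      by apply: (H0_coef ur vE) => //; rewrite -sE.
    by exists u; [exact: (Sface_le_Nu smoothDelta uP uN v0)|exists (v u)].
  move: s; apply: lspan_sub => [s [u uS [v vN <-]]||c s s']; last 2 first.
  - exact: H0_0.
  - exact: H0_lin.
  by apply: H0_term => //; exact: (Sface_polytope smoothDelta uS).
move=> r x ur xS x0 u ru.
(* Independence of terms is stated for a family over all exponents, so the [v] are extended by [0]
   outside [r]. *)
have /boolp.choice[v vP] : forall u, exists v : kv,
    ext_power setT v /\ (u \in r -> term u v = x u).
  move=> w; have [/xS[_ [v vN <-]]|wr] := boolP (w \in r).
    by exists v; split=> //; move: vN; rewrite (NuE smoothDelta) => -[].
  by exists 0; split=> //; exact: lspan0.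
have s0 : \sum_(u <- r) term u (v u) = 0.
  by rewrite -[RHS]x0 [LHS]big_seq [RHS]big_seq; apply: eq_bigr => w /(vP w).2.
rewrite -(vP u).2// (terms_free ur _ s0 ru) ?term0// => w; exact: (vP w).1.
Qed.

Lemma summand_weight u : Sface_le Delta k u ->
  summand Delta k u = weight_space (H0 Delta k) (- u).
Proof.
move=> /(Sface_polytope smoothDelta) uP; apply/seteqP; split=> s.
  by move=> [v vN <-]; split=> [|t]; [exact: H0_term|exact: torus_act_term].
move=> [Hs st]; have [r [v [ur vE sE]]] := H0_terms Hs.
(* Subtracting [chi (- u) t *: s] from [torus_act t s] multiplies the coefficient at each exponent
   [a] by [c a]. The result is zero, while [c w] is nonzero for a [t] that separates the two
   characters. *)
have v0 w : w \in r -> w != u -> v w = 0.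
  move=> rw wu; have [t ct] : exists t : @torus R n, chi (- w) t != chi (- u) t.
    by apply: chi_sep; rewrite eqr_opp.
  pose c w := chi (- w) t - chi (- u) t.
  have : \sum_(w <- r) term w (c w *: v w) = 0.
    transitivity (torus_act t s - chi (- u) t *: s); last by rewrite st subrr.
    have -> : torus_act t s = \sum_(w <- r) chi (- w) t *: term w (v w).
      rewrite sE; elim: {ur sE rw} r => [|a r IH].
        by rewrite !big_nil; apply/funext => f; exact: val_inj.
      rewrite !big_cons -[term a _]scale1r torus_act_lin !scale1r torus_act_term.
      by rewrite IH.
    rewrite sE scaler_sumr -sumrB; apply: eq_bigr => a _.
    have := term_lin a (c a) (v a) 0; rewrite addr0 term0 addr0 => ->.
    by rewrite scalerBl.
  move=> /(terms_free ur)/(_ w rw) => cv.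
  have nz : c w \is a GRing.unit by rewrite unitfE subr_eq0.
  rewrite -[v w](scalerK nz) cv ?scaler0// => a.
  by rewrite -[_ *: _]addr0; apply: lspan_lin; [exact: vE|exact: lspan0].
have [ru|ru] := boolP (u \in r); last first.
  exists 0; first by rewrite (NuE smoothDelta); exact: vanishing0.
  rewrite sE big_seq big1 => [|w rw].
    exact: term0.
  by rewrite v0 ?term0//; apply: contraNneq ru => <-.
exists (v u).
  have [->|vu0] := eqVneq (v u) 0.
    by rewrite (NuE smoothDelta); exact: vanishing0.
  by have [] : polytope Delta (map_mx intr u) /\ Nu Delta k u (v u);
    [apply: (H0_coef ur vE) => //; rewrite -sE|].
rewrite sE (bigD1_seq u)//= big_seq_cond big1 ?addr0// => w /andP[rw wu].
by rewrite v0 ?term0.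
Qed.

Lemma has_dim_summand (i : nat) u : Sface Delta i u ->
  has_dim (summand Delta k u) (if (i <= k)%N then 'C(n - i, k - i) else 0%N).
Proof.
move=> /(has_dim_Nu smoothDelta k); apply: has_dim_image => [c v w|v].
  exact: term_lin.
rewrite (NuE smoothDelta) => -[vE _] v0.
have s0 : \sum_(w <- [:: u]) term w v = 0 by rewrite big_seq1.
by apply: (terms_free (v := fun=> v) _ _ s0 (u := u)) => //; rewrite inE.
Qed.

End GlobalSections.

Theorem theorem3p2 (R : realType) (n k : nat) (Delta : set (set 'rV[R]_n))
    (hDelta : smooth_fan Delta) (hcomplete : complete_fan Delta)
    (hk : (1 <= k <= n)%N) :
  [/\ is_direct_sum (H0 Delta k) (Sface_le Delta k)
        (summand Delta k),
      forall u : 'cV[int]_n, Sface_le Delta k u ->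
        summand Delta k u = weight_space (H0 Delta k) (- u)
    & forall (i : nat) (u : 'cV[int]_n), (i <= n)%N -> Sface Delta i u ->
        has_dim (summand Delta k u)
          (if (i <= k)%N then 'C(n - i, k - i) else 0%N)].
Proof.
split; first exact: summands_direct.
  by move=> u; exact: summand_weight.
by move=> i u _; exact: has_dim_summand.
Qed.
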